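(* The algebras $R_{4,k^2,d}$ and $R_{5,8,d}$ have the weak Lefschetz property for all integers $k\ge 2$ and all integers $d\ge 1$.
   Context: Let $\Bbbk$ be a field of characteristic zero. For positive integers $n,m,d$, $R_{n,m,d}=\Bbbk[x_1,\ldots,x_n]/(\ell_1^d,\ldots,\ell_m^d)$, where $\ell_1,\ldots,\ell_m$ are general linear forms, i.e. for each $(n,m,d)$ the statement holds for all $(\ell_1,\dots,\ell_m)$ in some nonempty Zariski open subset of the space of $m$-tuples of linear forms. An artinian standard graded algebra $A$ has the weak Lefschetz property (WLP) if for a general linear form $\ell$ every multiplication map $\times\ell\colon A_i\to A_{i+1}$ has maximal rank (equivalently, the Hilbert series of $A/(\ell)$ equals $(1-t)$ times the Hilbert series of $A$, truncated at the first non-positive term). *)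

(* Defs.v *)
From HB Require Import structures.
From mathcomp Require Import all_boot all_order all_algebra.
From mathcomp Require Import mpoly.
From mathcomp Require boolp.

Set Implicit Arguments.
Unset Strict Implicit.
Unset Printing Implicit Defensive.

Import GRing.Theory.

Local Open Scope ring_scope.
Local Open Scope quotient_scope.

(* The affine space K^(m * n) is taken to be 'M[K]_(m, n), with the entries as
   coordinates.  It parametrizes the m-tuples of linear forms in n variables
   (one form per row), and for m = 1 a single linear form. *)
Definition zariski_open (K : fieldType) m n (U : 'M[K]_(m, n) -> Prop) : Prop :=
  exists S : {mpoly K[m * n]} -> Prop,
    forall M, U M <-> exists2 p, S p & p.@[fun j => mxvec M 0 j] != 0.

Definition generically (K : fieldType) m n (P : 'M[K]_(m, n) -> Prop) : Prop :=
  exists U : 'M[K]_(m, n) -> Prop,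
    [/\ zariski_open U, exists M, U M & forall M, U M -> P M].

Definition linear_form (K : fieldType) n (a : 'rV[K]_n) : {mpoly K[n]} :=
  \sum_(j < n) a 0 j *: 'X_j.

Definition is_ideal (A : comNzRingType) (J : A -> Prop) : Prop :=
  [/\ J 0, forall a b, J a -> J b -> J (a + b) & forall a b, J b -> J (a * b)].

Definition artinian (A : comNzRingType) : Prop :=
  forall J : nat -> A -> Prop,
    (forall i, is_ideal (J i)) ->
    (forall i a, J i.+1 a -> J i a) ->
    exists N : nat, forall i, (N <= i)%N -> forall a, J i a <-> J N a.

Section StandardGraded.
Variables (K : fieldType) (n : nat) (I : idealr {mpoly K[n]}).

(* The graded pieces A_i of A = K[x_1, ..., x_n] / I; this is a grading when I
   is homogeneous. *)
Definition graded_piece (i : nat) (a : {ideal_quot I}) : Prop :=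
  exists2 p : {mpoly K[n]}, p \is i.-homog & a = \pi_{ideal_quot I} p.

(* A linear map between finite-dimensional spaces has maximal rank iff it is
   injective or surjective. *)
Definition mul_max_rank (l : {ideal_quot I}) (i : nat) : Prop :=
  (forall a b, graded_piece i a -> graded_piece i b -> l * a = l * b -> a = b)
  \/ (forall b, graded_piece i.+1 b -> exists2 a, graded_piece i a & l * a = b).

Definition weak_lefschetz : Prop :=
  artinian {ideal_quot I} /\
  generically (fun a : 'rV[K]_n =>
    forall i, mul_max_rank (\pi_{ideal_quot I} (linear_form a)) i).

End StandardGraded.

Section PowerIdeal.
Variables (K : fieldType) (n m d : nat).

(* The ideal (l_1^d, ..., l_m^d), where l_i is the i-th row of L.  The argument
   d_gt0 makes the ideal proper, as ring quotients by ideals require. *)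
Definition power_ideal (d_gt0 : (0 < d)%N) (L : 'M[K]_(m, n)) :
    {mpoly K[n]} -> bool :=
  fun p => boolp.asbool (exists c : 'I_m -> {mpoly K[n]},
    p = \sum_(i < m) c i * linear_form (row i L) ^+ d).

Variables (d_gt0 : (0 < d)%N) (L : 'M[K]_(m, n)).

Lemma power_ideal_closed : idealr_closed (power_ideal d_gt0 L).
Proof.
split.
- apply/boolp.asboolP; exists (fun=> 0).
  by rewrite big1 // => i _; rewrite mul0r.
- apply/negP => /boolp.asboolP [c /(congr1 (meval (fun=> 0)))].
  rewrite meval1 rmorph_sum big1 => [/eqP|i _]; first by rewrite oner_eq0.
  rewrite /= mevalM rmorphXn /linear_form [X in X ^+ d](_ : _ = 0).
    by rewrite expr0n eqn0Ngt d_gt0 mulr0.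
  by rewrite rmorph_sum big1 // => j _; rewrite /= mevalZ mevalXU mulr0.
- move=> a u v /boolp.asboolP [cu ->] /boolp.asboolP [cv ->].
  apply/boolp.asboolP; exists (fun i => a * cu i + cv i).
  rewrite mulr_sumr -big_split /=; apply: eq_bigr => i _.
  by rewrite mulrDl mulrA.
Qed.

HB.instance Definition _ :=
  isIdealr.Build {mpoly K[n]} (power_ideal d_gt0 L) power_ideal_closed.

Definition power_idealr : idealr {mpoly K[n]} := power_ideal d_gt0 L.

End PowerIdeal.

(* Main.v *)
(* Modulo a general linear form l, the forms l_j become general forms l'_j in one
   variable less.  Let Psi_nu map (c_j), with the c_j of degree nu, to the sum of
   the c_j * l'_j ^ d.  If Psi_nu is surjective, so is multiplication by l onto
   degree nu + d.  If Psi_nu is injective, a relation l * p = \sum_j c_j * l_j ^ d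
   has all c_j divisible by l, hence multiplication by l is injective.  Maximal
   rank of Psi_nu is an open condition, and only finitely many nu matter, so one
   good tuple of forms for each nu is enough.

   By apolarity, the cokernel of Psi_nu is dual to the space of forms of degree
   i = nu + d vanishing to order mu = nu + 1 at the points with coordinates l'_j.
   In the plane, the k ^ 2 points are put close to the rational curve y = x ^ k.
   When z = y - x ^ k is rescaled towards 0, the forms of degree i degenerate to
   the span of the z ^ r * x ^ (a + k * c) with a < k and a + c + k * r <= i.  A
   point on the curve imposes mu - r conditions on row r.  A point off the curve
   imposes mu - 1 - r conditions on row r < mu, and mu conditions on row mu.
   Moving a suitable number b of points off the curve makes all the rows have
   at most, or all of them at least, as many elements as conditions.
   In space, the 8 points lie on the curve (1 : x : x ^ 2 : x ^ 4), and the rows are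
   indexed by the powers of two quadrics cutting it out. *)
From HB Require Import structures.
Require Import Defs.
From mathcomp Require Import all_boot all_order all_algebra.
From mathcomp Require Import mpoly.
From mathcomp Require boolp.
From mathcomp Require Import zify ring.

Set Implicit Arguments.
Unset Strict Implicit.
Unset Printing Implicit Defensive.

Import GRing.Theory.
Local Open Scope ring_scope.
Local Open Scope quotient_scope.

(** * Natural numbers as scalars in characteristic zero *)

Section CharZero.
Variables (K : fieldType) (charK : [pchar K] =i pred0).

Lemma natf_eq0 n : (n%:R == 0 :> K) = (n == 0)%N.
Proof. exact: ((pcharf0P K).1 charK). Qed.

Lemma natf_inj : injective (fun n => n%:R : K).
Proof.
have aux a b : (a <= b)%N -> a%:R = b%:R :> K -> a = b.
  move=> leab e; apply/eqP; rewrite eqn_leq leab -subn_eq0 -natf_eq0 natrB //.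
  by rewrite e subrr eqxx.
move=> a b e; case/orP: (leq_total a b) => /aux h; first exact: h.
by apply/esym/h/esym.
Qed.

(** The first [size p] natural numbers are distinct in [K], one more than [p] can have roots. *)
Lemma poly_nonroot (p : {poly K}) : p != 0 -> exists u, p.[u] != 0.
Proof.
move=> p0; apply: boolp.contrapT => np.
have /max_poly_roots/(_ _) : all (root p) [seq n%:R | n <- iota 0 (size p)].
  by apply/allP => x _; apply/negPn/negP => nx; apply: np; exists x.
move/(_ p0); rewrite size_map size_iota ltnn map_inj_uniq ?iota_uniq //.
  by move/(_ isT).
exact: natf_inj.
Qed.

End CharZero.

(** * Polynomial functions on spaces of matrices *)

Section PolyFun.
Variables (K : fieldType) (m n : nat).
Implicit Types (f g : 'M[K]_(m, n) -> K).

Definition polyfun f :=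
  exists p : {mpoly K[m * n]}, forall M, f M = p.@[fun j => mxvec M 0 j].

Lemma polyfun_const c : polyfun (fun=> c).
Proof. by exists c%:MP => M; rewrite mevalC. Qed.

Lemma polyfun_entry i j : polyfun (fun M => M i j).
Proof. by exists 'X_(mxvec_index i j) => M; rewrite mevalXU mxvecE. Qed.

Lemma polyfunD f g : polyfun f -> polyfun g -> polyfun (fun M => f M + g M).
Proof. by move=> [p hp] [q hq]; exists (p + q) => M; rewrite mevalD hp hq. Qed.

Lemma polyfunM f g : polyfun f -> polyfun g -> polyfun (fun M => f M * g M).
Proof. by move=> [p hp] [q hq]; exists (p * q) => M; rewrite mevalM hp hq. Qed.

Lemma polyfun_ext f g : f =1 g -> polyfun f -> polyfun g.
Proof. by move=> e [p hp]; exists p => M; rewrite -e hp. Qed.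

Lemma polyfun_sum (I : Type) (r : seq I) (P : pred I) (F : I -> _ -> K) :
  (forall i, P i -> polyfun (F i)) -> polyfun (fun M => \sum_(i <- r | P i) F i M).
Proof.
move=> h; elim: r => [|i r IH].
  by apply: polyfun_ext (polyfun_const 0) => M; rewrite big_nil.
case Pi: (P i); last by apply: polyfun_ext IH => M; rewrite big_cons Pi.
by apply: polyfun_ext (polyfunD (h i Pi) IH) => M; rewrite big_cons Pi.
Qed.

Lemma polyfun_prod (I : Type) (r : seq I) (P : pred I) (F : I -> _ -> K) :
  (forall i, P i -> polyfun (F i)) -> polyfun (fun M => \prod_(i <- r | P i) F i M).
Proof.
move=> h; elim: r => [|i r IH].
  by apply: polyfun_ext (polyfun_const 1) => M; rewrite big_nil.
case Pi: (P i); last by apply: polyfun_ext IH => M; rewrite big_cons Pi.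
by apply: polyfun_ext (polyfunM (h i Pi) IH) => M; rewrite big_cons Pi.
Qed.

Lemma polyfun_exp f e : polyfun f -> polyfun (fun M => f M ^+ e).
Proof.
move=> pf; apply: polyfun_ext (@polyfun_prod _ (iota 0 e) predT
  (fun _ => f) (fun _ _ => pf)) => M.
by rewrite -[RHS]iter_mulr_1 big_const_seq count_predT size_iota.
Qed.

Lemma polyfun_det k (A : 'M[K]_(m, n) -> 'M[K]_k) :
  (forall i j, polyfun (fun M => A M i j)) -> polyfun (fun M => \det (A M)).
Proof.
move=> h; apply: polyfun_sum => s _; apply: polyfunM (polyfun_const _) _.
by apply: polyfun_prod => i _.
Qed.

Lemma polyfun_meval k (p : {mpoly K[k]}) (v : 'M[K]_(m, n) -> 'I_k -> K) :
  (forall i, polyfun (fun M => v M i)) -> polyfun (fun M => p.@[v M]).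
Proof.
move=> h; apply: (@polyfun_ext (fun M =>
  \sum_(x <- msupp p) p@_x * \prod_i v M i ^+ x i)).
  by move=> M; rewrite [p in RHS]mpolyE raddf_sum /=; apply: eq_bigr => x _;
    rewrite mevalZ mevalX.
apply: polyfun_sum => x _; apply: polyfunM (polyfun_const _) _.
by apply: polyfun_prod => i _; apply: polyfun_exp.
Qed.

End PolyFun.

(** * Nonempty principal open sets *)

Section DenseOpen.
Variables (K : fieldType) (charK : [pchar K] =i pred0) (m n : nat).
Implicit Types (P Q : 'M[K]_(m, n) -> Prop).

(** One polynomial function stands for the open set, so that intersections become products. *)
Definition dense_open P :=
  exists2 f : 'M[K]_(m, n) -> K, polyfun f &
    (exists M, f M != 0) /\ forall M, f M != 0 -> P M.

Lemma dense_open_generically P : dense_open P -> generically P.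
Proof.
case=> f [p hp] [[M0 fM0] fP]; exists (fun M => f M != 0); split=> //.
  exists (eq p) => M; rewrite hp; split; first by move=> h; exists p.
  by case=> _ <-.
by exists M0.
Qed.

Lemma dense_open_sub P Q : (forall M, P M -> Q M) -> dense_open P -> dense_open Q.
Proof. by move=> PQ [f pf [ex fP]]; exists f => //; split=> // M /fP/PQ. Qed.

Lemma dense_openT : dense_open (fun=> True).
Proof.
exists (fun=> 1); first exact: polyfun_const.
by split=> //; exists 0; rewrite oner_neq0.
Qed.

Lemma polyfun_line (f : 'M[K]_(m, n) -> K) (A B : 'M[K]_(m, n)) :
  polyfun f -> exists q : {poly K}, forall u, q.[u] = f (A + u *: B).
Proof.
case=> p hp.
pose v j : {poly K} := (mxvec A 0 j)%:P + (mxvec B 0 j) *: 'X.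
exists (mmap polyC v p) => u.
rewrite hp [p]mpolyE !raddf_sum /= horner_sum; apply: eq_bigr => x _.
rewrite mmapZ mmapX mevalZ mevalX hornerM hornerC /mmap1 horner_prod.
congr (_ * _); apply: eq_bigr => j _; rewrite horner_exp /v.
by rewrite hornerD hornerC hornerZ hornerX linearD linearZ /= !mxE mulrC.
Qed.

(* Two polynomial functions that do not vanish at A and at A + B restrict to
   nonzero polynomials on the line through these points. *)
Lemma dense_openI P Q : dense_open P -> dense_open Q ->
  dense_open (fun M => P M /\ Q M).
Proof.
case=> f pf [[A fA] fP] [g pg [[B gB] gQ]].
exists (fun M => f M * g M); first exact: polyfunM.
split; last by move=> M; rewrite mulf_eq0 negb_or => /andP[/fP ? /gQ ?].
have [q hq] := polyfun_line A (B - A) pf; have [r hr] := polyfun_line A (B - A) pg.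
have q0 : q != 0.
  apply: contraNneq fA => q0.
  by rewrite -[A]addr0 -(scale0r (B - A)) -hq q0 horner0.
have r0 : r != 0.
  apply: contraNneq gB => r0.
  by rewrite -[B](subrK A) addrC -(scale1r (B - A)) -hr r0 horner0.
have [u] := poly_nonroot charK (mulf_neq0 q0 r0).
by rewrite hornerM hq hr => h; exists (A + u *: (B - A)).
Qed.

Lemma dense_open_all (b : nat) (P : nat -> 'M[K]_(m, n) -> Prop) :
  (forall i, (i < b)%N -> dense_open (P i)) ->
  dense_open (fun M => forall i, (i < b)%N -> P i M).
Proof.
elim: b => [|b IH] h; first by apply: dense_open_sub dense_openT.
have := dense_openI (IH (fun i ib => h i (ltnW ib))) (h b (ltnSn b)).
apply: dense_open_sub => M [hb hP] i; rewrite ltnS leq_eqVlt => /orP[/eqP->//|].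
exact: hb.
Qed.

(** With [B] and [C] taken from the rank decomposition of [A M0], the product [B *m A M0 *m C] is
    the identity. The determinant of [B *m A M *m C] is polynomial in [M] and nonzero at [M0], and
    wherever it is nonzero the rank is at least [r]. *)
Lemma dense_open_rank p q (A : 'M[K]_(m, n) -> 'M[K]_(p, q)) r :
  (forall i j, polyfun (fun M => A M i j)) -> (exists M, (r <= \rank (A M))%N) ->
  dense_open (fun M => (r <= \rank (A M))%N).
Proof.
move=> pA [M0 hr].
have [B [C hBC]] : exists B : 'M_(r, p), exists C : 'M_(q, r),
    \det (B *m A M0 *m C) != 0.
  have [B [C e]] : exists B : 'M_(r, p), exists C : 'M_(q, r),
      B *m A M0 *m C = 1%:M.
    exists (pid_mx r *m invmx (col_ebase (A M0))).
    exists (invmx (row_ebase (A M0)) *m pid_mx r).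
    rewrite -[X in _ *m X *m _]mulmx_ebase !mulmxA mulmxKV ?col_ebase_unit //.
    rewrite -!mulmxA mulKVmx ?row_ebase_unit // !mulmxA !mul_pid_mx.
    rewrite -[RHS]pid_mx_1; congr pid_mx.
    have := leq_trans hr (rank_leq_row _); have := leq_trans hr (rank_leq_col _).
    by move=> rq rp; lia.
  by exists B; exists C; rewrite e det1 oner_neq0.
exists (fun M => \det (B *m A M *m C)).
  apply: polyfun_det => i j.
  apply: (@polyfun_ext _ _ _ (fun M => \sum_k (\sum_l B i l * A M l k) * C k j)).
    by move=> M; rewrite !mxE; apply: eq_bigr => k _; rewrite !mxE.
  apply: polyfun_sum => k _; apply: polyfunM; last exact: polyfun_const.
  by apply: polyfun_sum => l _; apply: polyfunM; first exact: polyfun_const.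
split=> [|M]; first by exists M0.
rewrite -unitfE -[_ \is a _]/(_ \in unitmx) => /mxrank_unit {1}<-.
by apply: leq_trans (mxrankM_maxl _ _) _; apply: mxrankM_maxr.
Qed.

End DenseOpen.

(** * Monomials of a given degree and the multinomial expansion *)

Section Monomials.
Variable n : nat.

Definition monos i : seq 'X_{1..n} := [seq s2m (val t) | t <- enum (basis n i)].

Lemma mem_monos i m : (m \in monos i) = (mdeg m == i).
Proof. by rewrite basis_cover. Qed.

Lemma monos_uniq i : uniq (monos i).
Proof. exact: uniq_basis. Qed.

Lemma mdeg_s2m (s : seq 'I_n) : mdeg (s2m s) = size s.
Proof.
elim: s => [|k s IH]; first by rewrite mdegE big1 // => j _; rewrite mnmE.
rewrite -[size _]/(size s).+1 -IH !mdegE (bigD1 k) //= [in RHS](bigD1 k) //=.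
rewrite !mnmE /= eqxx -addSn add1n; congr (_ + _)%N; apply: eq_bigr => j jk.
by rewrite !mnmE /= eq_sym (negbTE jk).
Qed.

Lemma prod_s2m (R : comPzSemiRingType) (y : 'I_n -> R) (s : seq 'I_n) :
  \prod_(k <- s) y k = \prod_k y k ^+ s2m s k.
Proof.
elim: s => [|k s IH].
  by rewrite big_nil big1 // => j _; rewrite mnmE.
rewrite big_cons IH (bigD1 k) //= [in RHS](bigD1 k) //= !mnmE /= eqxx.
rewrite add1n exprS mulrA; congr (_ * _); apply: eq_bigr => j jk.
by rewrite !mnmE /= eq_sym (negbTE jk).
Qed.

(* The multinomial coefficient of m. *)
Definition words (m : 'X_{1..n}) : nat :=
  #|[set f : {ffun 'I_(mdeg m) -> 'I_n} | s2m (codom f) == m]|.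

Lemma words_gt0 m : (0 < words m)%N.
Proof.
have sz : size (m2s m) == mdeg m by rewrite size_m2s.
apply/card_gt0P; exists [ffun j => tnth (Tuple sz) j]; rewrite inE; apply/eqP.
rewrite -[RHS]s2mK; congr s2m; rewrite codomE (eq_map (ffunE _)).
exact: map_tnth_enum.
Qed.

(** The power is a sum over words of length [i] in the indices, and words with the same letter
    counts give the same monomial. *)
Lemma expr_sum_words (R : comPzSemiRingType) (t : 'I_n -> R) i :
  (\sum_k t k) ^+ i = \sum_(m <- monos i) (\prod_k t k ^+ m k) *+ words m.
Proof.
have -> : (\sum_k t k) ^+ i = \prod_(j < i) \sum_k t k.
  by rewrite prodr_const card_ord.
rewrite bigA_distr_bigA /=.
transitivity (\sum_(f : {ffun 'I_i -> 'I_n}) \prod_k t k ^+ s2m (codom f) k).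
  apply: eq_bigr => f _; rewrite -prod_s2m codomE big_map enumT.
  by rewrite /index_enum; case: index_enum_key.
transitivity (\sum_(f : {ffun 'I_i -> 'I_n}) \sum_(m <- monos i)
    (\prod_k t k ^+ m k) *+ (s2m (codom f) == m)).
  apply: eq_bigr => f _.
  have fm : s2m (codom f) \in monos i.
    by rewrite mem_monos mdeg_s2m size_codom card_ord.
  rewrite (bigD1_seq _ fm (monos_uniq i)) /= eqxx mulr1n [X in _ + X]big1 ?addr0 // => m.
  by rewrite eq_sym => /negbTE->.
rewrite exchange_big /=; apply: eq_big_seq => m; rewrite mem_monos => /eqP <-.
rewrite sumrMnr; congr (_ *+ _).
by rewrite /words -sum1dep_card [RHS]big_mkcond; apply: eq_bigr => f _; case: eqP.
Qed.

Lemma homog_monosE (R : nzRingType) (p : {mpoly R[n]}) i :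
  p \is i.-homog -> p = \sum_(m <- monos i) p@_m *: 'X_[m].
Proof.
move=> hp; apply/mpolyP => m; rewrite linear_sum /=.
case: (boolP (m \in monos i)) => hm.
  rewrite (bigD1_seq _ hm (monos_uniq i)) /= mcoeffZ mcoeffX eqxx mulr1.
  rewrite big1 ?addr0 // => k /negbTE km.
  by rewrite mcoeffZ mcoeffX km mulr0.
rewrite big1_seq => [|k /andP[_ hk]].
  by rewrite (dhomog_nemf_coeff hp) // -mem_monos.
rewrite mcoeffZ mcoeffX; case: eqP => [km|]; last by rewrite mulr0.
by rewrite -km hk in hm.
Qed.

End Monomials.

Lemma size_monos n i : size (monos n.+1 i) = 'C(i + n, i).
Proof. exact: size_basis. Qed.

(** * The matrix of Psi_nu *)

Section PowerMap.
Variables (K : fieldType) (n m d nu : nat).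
Implicit Types (L : 'M[K]_(m, n)) (c : 'I_m -> {mpoly K[n]}).

Lemma linear_form_homog (a : 'rV[K]_n) : linear_form a \is 1.-homog.
Proof. by apply: rpred_sum => j _; apply: dhomogZ; rewrite dhomogX /= mdeg1. Qed.

Lemma linear_form_exp_homog (a : 'rV[K]_n) e : linear_form a ^+ e \is e.-homog.
Proof. by have := dhomogMn e (linear_form_homog a); rewrite mul1n. Qed.

Definition power_sum L c := \sum_(j < m) c j * linear_form (row j L) ^+ d.

Lemma eq_power_sum L c c' : c =1 c' -> power_sum L c = power_sum L c'.
Proof. by move=> e; apply: eq_bigr => j _; rewrite e. Qed.

Lemma power_sum_homog L c :
  (forall j, c j \is nu.-homog) -> power_sum L c \is (nu + d).-homog.
Proof.
by move=> hc; apply: rpred_sum => j _; rewrite dhomogM ?linear_form_exp_homog.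
Qed.

Local Notation mon i k := (nth 0%MM (monos n i) k).

(** Row vectors are tuples of forms of degree [nu], and right multiplication by this matrix is
    Psi_nu: [row_free] means injective and [row_full] means surjective. *)
Definition power_mx L : 'M[K]_(#|{: 'I_m * 'I_(size (monos n nu))}|,
                                size (monos n (nu + d))) :=
  \matrix_(r < #|{: 'I_m * 'I_(size (monos n nu))}|, k < size (monos n (nu + d)))
    ('X_[mon nu (enum_val r).2] *
     linear_form (row (enum_val r).1 L) ^+ d)@_(mon (nu + d) k).

Lemma big_monos (R : nmodType) i (F : 'X_{1..n} -> R) :
  \sum_(x <- monos n i) F x = \sum_(k < size (monos n i)) F (mon i k).
Proof. by rewrite (big_nth 0%MM) big_mkord. Qed.

Lemma mul_power_mx L (v : 'rV[K]_#|{: 'I_m * 'I_(size (monos n nu))}|) k :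
  (v *m power_mx L) 0 k =
    (power_sum L (fun j => \sum_(a < size (monos n nu))
       v 0 (enum_rank (j, a)) *: 'X_[mon nu a]))@_(mon (nu + d) k).
Proof.
rewrite mxE (reindex_onto (@enum_rank _) (@enum_val _ _)) /=; last first.
  by move=> r _; rewrite enum_valK.
rewrite raddf_sum /= (eq_bigl xpredT) => [|r]; last by rewrite enum_rankK eqxx.
pose F j a := v 0 (enum_rank (j, a)) * ('X_[mon nu a] *
  linear_form (row j L) ^+ d)@_(mon (nu + d) k).
rewrite (eq_bigr (fun p => F p.1 p.2)) => [|[j a] _]; last first.
  by rewrite /F mxE enum_rankK.
rewrite -(pair_bigA _ F) /=; apply: eq_bigr => j _.
rewrite mulr_suml raddf_sum /=; apply: eq_bigr => a _.
by rewrite -scalerAl mcoeffZ.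
Qed.

Lemma homog_eq i (p q : {mpoly K[n]}) : p \is i.-homog -> q \is i.-homog ->
  (forall k : 'I_(size (monos n i)), p@_(mon i k) = q@_(mon i k)) -> p = q.
Proof.
move=> hp hq e; rewrite (homog_monosE hp) (homog_monosE hq) !big_monos.
by apply: eq_bigr => k _; rewrite e.
Qed.

Lemma power_mx_inj L c : row_free (power_mx L) ->
  (forall j, c j \is nu.-homog) -> power_sum L c = 0 -> forall j, c j = 0.
Proof.
move=> free hc c0 j.
pose v : 'rV[K]_#|{: 'I_m * 'I_(size (monos n nu))}| :=
  \row_(r < #|{: 'I_m * 'I_(size (monos n nu))}|) (c (enum_val r).1)@_(mon nu (enum_val r).2).
have ec l : \sum_(a < size (monos n nu)) v 0 (enum_rank (l, a)) *: 'X_[mon nu a] = c l.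
  rewrite [RHS](homog_monosE (hc l)) big_monos; apply: eq_bigr => a _.
  by rewrite mxE enum_rankK.
have v0 : v = 0.
  apply: (row_free_inj free); rewrite mul0mx; apply/rowP => k.
  rewrite mul_power_mx mxE -[RHS](mcoeff0 _ (mon (nu + d) k)) -[in RHS]c0.
  by congr mcoeff; apply: eq_power_sum => l; exact: ec.
by rewrite -ec v0 big1 // => a _; rewrite mxE scale0r.
Qed.

Lemma power_mx_surj L p : row_full (power_mx L) -> p \is (nu + d).-homog ->
  exists c, p = power_sum L c.
Proof.
move=> full hp; pose w : 'rV[K]_(size (monos n (nu + d))) := \row_k p@_(mon (nu + d) k).
have /submxP[v wv] : (w <= power_mx L)%MS by rewrite submx_full.
exists (fun j => \sum_(a < size (monos n nu)) v 0 (enum_rank (j, a)) *: 'X_[mon nu a]).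
apply: homog_eq hp _ _ => [|k].
  apply: power_sum_homog => j; apply: rpred_sum => a _.
  by apply: dhomogZ; rewrite dhomogX /= -mem_monos mem_nth.
by rewrite -mul_power_mx -wv mxE.
Qed.

End PowerMap.

(** * Polynomial dependence of this matrix on the linear forms *)

Section PowerMxPolyfun.
Variables (K : fieldType) (n m : nat).

Lemma mcoeff_linear_form_exp_polyfun j e (x : 'X_{1..n}) :
  polyfun (fun L : 'M[K]_(m, n) => (linear_form (row j L) ^+ e)@_x).
Proof.
elim: e x => [|e IH] x.
  exact: (polyfun_ext _ (polyfun_const _ _ (1 : {mpoly K[n]})@_x)).
apply: (@polyfun_ext _ _ _ (fun L => \sum_(k : 'X_{1..n < (mdeg x).+1, (mdeg x).+1} |
   x == (k.1 + k.2)%MM) (linear_form (row j L))@_k.1 *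
     (linear_form (row j L) ^+ e)@_k.2)).
  by move=> L; rewrite exprS mcoeffM.
apply: polyfun_sum => k _; apply: polyfunM => //.
apply: (@polyfun_ext _ _ _ (fun L => \sum_l L j l * ('X_l : {mpoly K[n]})@_k.1)).
  move=> L; rewrite raddf_sum /=; apply: eq_bigr => l _.
  by rewrite mcoeffZ mxE.
apply: polyfun_sum => l _; apply: polyfunM; first exact: polyfun_entry.
exact: polyfun_const.
Qed.

Lemma power_mx_polyfun d nu r k :
  polyfun (fun L : 'M[K]_(m, n) => power_mx d nu L r k).
Proof.
set x := nth 0%MM (monos n nu) (enum_val r).2.
set y := nth 0%MM (monos n (nu + d)) k.
apply: (@polyfun_ext _ _ _ (fun L => \sum_(k : 'X_{1..n < (mdeg y).+1, (mdeg y).+1} |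
   y == (k.1 + k.2)%MM) ('X_[x] : {mpoly K[n]})@_k.1 *
     (linear_form (row (enum_val r).1 L) ^+ d)@_k.2)).
  by move=> L; rewrite mxE mcoeffM.
apply: polyfun_sum => l _; apply: polyfunM; first exact: polyfun_const.
exact: mcoeff_linear_form_exp_polyfun.
Qed.

End PowerMxPolyfun.

(** * Divisibility of the low coefficients of a power *)

Section CoefDivides.
Variables (S : comNzRingType) (u : S).

Definition pow_dvd e (x : S) := exists w, x = u ^+ e * w.

Lemma pow_dvd_sum e (I : Type) (r : seq I) (F : I -> S) :
  (forall i, pow_dvd e (F i)) -> pow_dvd e (\sum_(i <- r) F i).
Proof.
move=> h; elim: r => [|i r [w IH]]; first by exists 0; rewrite big_nil mulr0.
by have [w' hi] := h i; exists (w' + w); rewrite big_cons IH hi mulrDr.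
Qed.

Lemma pow_dvd_leq e e' x : (e <= e')%N -> pow_dvd e' x -> pow_dvd e x.
Proof.
by move=> le [w ->]; exists (u ^+ (e' - e) * w); rewrite mulrA -exprD subnKC.
Qed.

Lemma pow_dvd_mul e x y : pow_dvd e x -> pow_dvd e (y * x).
Proof. by case=> w ->; exists (y * w); rewrite mulrCA. Qed.

(** Each of the [i] factors that does not contribute its constant coefficient [u] uses up at least
    one unit of [p + c], so at least [i - (p + c)] factors contribute [u]. *)
Lemma coef_exp_pow_dvd (f : {poly {poly S}}) i c p :
  f`_0`_0 = u -> pow_dvd (i - (p + c)) (f ^+ i)`_c`_p.
Proof.
move=> f0; elim: i c p => [|i IH] c p.
  by exists (1 : {poly {poly S}})`_c`_p; rewrite expr0 mul1r.
rewrite exprS coefM coef_sum; apply: pow_dvd_sum => -[c' /= c'c].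
rewrite coefM; apply: pow_dvd_sum => -[p' /= p'p].
have [/andP[/eqP-> /eqP->]|nz] := boolP ((c' == 0) && (p' == 0))%N.
  rewrite f0 !subn0; have [w ->] := IH c p.
  by apply: (@pow_dvd_leq _ (i - (p + c)).+1); [lia|exists w; rewrite exprS mulrA].
apply: pow_dvd_mul; apply: pow_dvd_leq (IH _ _); move: nz; lia.
Qed.

End CoefDivides.

(** * Apolarity between powers of linear forms and vanishing at points *)

Section Apolarity.
Variables (K : fieldType) (charK : [pchar K] =i pred0) (n : nat).
Implicit Types (G P : {mpoly K[n]}) (a : 'rV[K]_n).

(* The weights make pairing with the i-th power of the linear form with
   coefficient vector y the evaluation at y. *)
Definition apolar i G P : K :=
  \sum_(x <- monos n i) P@_x * (G@_x / (words x)%:R).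

(** For [G] of degree [i = nu + d] this is the dual form of vanishing to order [nu + 1] at the point
    [a]. *)
Definition vanishing d i G a := forall w, apolar i G (w * linear_form a ^+ d) = 0.

Lemma apolarDr i G P Q : apolar i G (P + Q) = apolar i G P + apolar i G Q.
Proof. by rewrite /apolar -big_split /=; apply: eq_bigr => x _; rewrite mcoeffD mulrDl. Qed.

Lemma apolarZr i G c P : apolar i G (c *: P) = c * apolar i G P.
Proof. by rewrite /apolar mulr_sumr; apply: eq_bigr => x _; rewrite mcoeffZ -mulrA. Qed.

Lemma apolar0r i G : apolar i G 0 = 0.
Proof. by rewrite -(scale0r 0) apolarZr mul0r. Qed.

Lemma apolar_sumr i G (I : Type) (r : seq I) (F : I -> {mpoly K[n]}) :
  apolar i G (\sum_(k <- r) F k) = \sum_(k <- r) apolar i G (F k).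
Proof.
elim: r => [|k r IH]; first by rewrite !big_nil apolar0r.
by rewrite !big_cons apolarDr IH.
Qed.

Lemma apolar_homog_neq i e G P : P \is e.-homog -> e != i -> apolar i G P = 0.
Proof.
move=> hP ei; rewrite /apolar big1_seq // => x /andP[_].
rewrite mem_monos => /eqP xi; rewrite (dhomog_nemf_coeff hP) ?mul0r //=.
by rewrite xi eq_sym.
Qed.

Lemma vanishing_monos d nu G a :
  (forall x, x \in monos n nu -> apolar (nu + d) G ('X_[x] * linear_form a ^+ d) = 0) ->
  vanishing d (nu + d) G a.
Proof.
move=> h w; rewrite [w]mpolyE mulr_suml apolar_sumr big1 // => x _.
rewrite -scalerAl apolarZr; have [/eqP xnu|xnu] := boolP (mdeg x == nu).
  by rewrite h ?mulr0 // mem_monos xnu.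
rewrite (@apolar_homog_neq _ (mdeg x + d)) ?mulr0 ?eqn_add2r //.
by apply: dhomogM; rewrite ?dhomogX ?linear_form_exp_homog.
Qed.

(** The matrix [A *m (power_mx d nu L)^T] holds the pairings of the forms [F b] with the products of
    monomials and powers. No nonzero combination of the [F b] is orthogonal to all of these, so the
    product is row free, and its rank bounds that of [power_mx] from below. *)
Lemma rank_power_mx m d nu (L : 'M[K]_(m, n)) (D : finType) (F : D -> {mpoly K[n]}) :
  (forall g : D -> K,
    (forall j, vanishing d (nu + d) (\sum_b g b *: F b) (row j L)) -> forall b, g b = 0) ->
  (#|D| <= \rank (power_mx d nu L))%N.
Proof.
move=> h; pose A : 'M[K]_(#|D|, size (monos n (nu + d))) :=
  \matrix_(b < #|D|, k < size (monos n (nu + d)))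
    ((F (enum_val b))@_(nth 0%MM (monos n (nu + d)) k) /
     (words (nth 0%MM (monos n (nu + d)) k))%:R).
have free : row_free (A *m (power_mx d nu L)^T).
  apply: inj_row_free => v v0.
  have g0 : forall b, v 0 (enum_rank b) = 0.
    apply: (h (fun b => v 0 (enum_rank b))) => j; apply: vanishing_monos => x hx.
    have xs : (index x (monos n nu) < size (monos n nu))%N by rewrite index_mem.
    have := congr1 (fun M : 'rV_ _ => M 0 (enum_rank (j, Ordinal xs))) v0.
    rewrite mulmxA !mxE => <-.
    rewrite /apolar big_monos; apply: eq_bigr => k _; rewrite !mxE.
    rewrite enum_rankK /= nth_index // mulrC; congr (_ * _).
    rewrite raddf_sum /= mulr_suml.
    rewrite (reindex_onto (@enum_rank D) (@enum_val D _)) /=; last first.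
      by move=> r _; rewrite enum_valK.
    rewrite [RHS](eq_bigl xpredT) => [|r]; last by rewrite enum_rankK eqxx.
    by apply: eq_bigr => b _; rewrite mcoeffZ !mxE enum_rankK mulrA.
  by apply/rowP => b; rewrite -(enum_valK b) g0 mxE.
move: free; rewrite /row_free => /eqP <-.
by rewrite (leq_trans (mxrankM_maxr _ _)) // mxrank_tr.
Qed.

Lemma natf_words (x : 'X_{1..n}) : (words x)%:R != 0 :> K.
Proof. by rewrite natf_eq0 // -lt0n words_gt0. Qed.

Lemma apolarX i G x : x \in monos n i -> apolar i G 'X_[x] = G@_x / (words x)%:R.
Proof.
move=> hx; rewrite /apolar (bigD1_seq _ hx (monos_uniq _ _)) /= mcoeffX eqxx mul1r.
rewrite big1 ?addr0 // => y yx; rewrite mcoeffX eq_sym (negbTE yx); exact: mul0r.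
Qed.

Lemma mmap_monosE (R : comNzRingType) (f : {rmorphism K -> R}) (y : 'I_n -> R) G i :
  G \is i.-homog ->
  mmap f y G = \sum_(x <- monos n i) f G@_x * \prod_k y k ^+ x k.
Proof.
move=> hG; rewrite /mmap [RHS](bigID (fun x => x \in msupp G)) /=.
rewrite [X in _ = _ + X]big1_seq => [|x /andP[]]; last first.
  by rewrite -mcoeff_eq0 => /eqP-> _; rewrite rmorph0 mul0r.
rewrite addr0 -[RHS]big_filter; apply: perm_big; apply: uniq_perm.
- exact: msupp_uniq.
- exact: filter_uniq (monos_uniq _ _).
move=> x; rewrite mem_filter mem_monos; case: (boolP (x \in msupp G)) => //= hx.
by rewrite (dhomog_mf hG hx) eqxx.
Qed.

Local Notation emb := (map_poly (map_poly (@mpolyC n K))).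

Lemma vanishing_coef d nu G a (y : 'I_n -> {poly {poly K}}) c p :
  G \is (nu + d).-homog -> vanishing d (nu + d) G a ->
  (forall k, (y k)`_0`_0 = a 0 k) -> (p + c <= nu)%N ->
  (mmap (polyC \o polyC) y G)`_c`_p = 0.
Proof.
move=> hG van ya pc.
pose ly := \sum_k emb (y k) * ('X_k)%:P%:P.
have ly0 : ly`_0`_0 = linear_form a.
  rewrite /ly !coef_sum; apply: eq_bigr => k _.
  by rewrite !coefMC !coef_map /= ya mul_mpolyC.
have -> : (mmap (polyC \o polyC) y G)`_c`_p = apolar (nu + d) G (ly ^+ (nu + d))`_c`_p.
  have -> := mmap_monosE (polyC \o polyC) y hG.
  rewrite /ly expr_sum_words !coef_sum apolar_sumr; apply: eq_big_seq => x hx.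
  have -> : \prod_k (emb (y k) * ('X_k)%:P%:P) ^+ x k =
      emb (\prod_k y k ^+ x k) * ('X_[x])%:P%:P.
    under eq_bigr do rewrite exprMn.
    rewrite big_split rmorph_prod /=; congr (_ * _).
      by apply: eq_bigr => k _; rewrite rmorphXn.
    rewrite mpolyXE_id !rmorph_prod; apply: eq_bigr => k _.
    by rewrite !rmorphXn.
  rewrite !coefMn !coefMC !coef_map /= mul_mpolyC -scaler_nat.
  rewrite !coefCM scalerA apolarZr apolarX //.
  by rewrite [RHS]mulrC mulrA divfK ?natf_words.
have [w ->] := @coef_exp_pow_dvd _ _ ly (nu + d) c p ly0.
have -> : (nu + d - (p + c) = (nu - (p + c)) + d)%N by lia.
by rewrite exprD mulrAC; apply: van.
Qed.

End Apolarity.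

(** * Sparse polynomials with prescribed multiplicities at general points *)

Section Sparse.
Variables (K : fieldType) (charK : [pchar K] =i pred0).

(** A right inverse [X] of the system at 0 gives a determinant [w] with value 1 at 0; where [w] is
    nonzero the system is injective. *)
Lemma generic_injective (B C : finType) (M : B -> C -> {poly K}) :
  (forall g : B -> K, (forall c, \sum_b g b * (M b c).[0] = 0) -> forall b, g b = 0) ->
  exists2 w : {poly K}, w != 0 & forall t, w.[t] != 0 ->
    forall g : B -> K, (forall c, \sum_b g b * (M b c).[t] = 0) -> forall b, g b = 0.
Proof.
move=> inj0.
pose A : 'M[{poly K}]_(#|B|, #|C|) :=
  \matrix_(i < #|B|, j < #|C|) M (enum_val i) (enum_val j).
pose At t := map_mx (horner_eval t) A.
have mulA t (v : 'rV[K]_#|B|) j :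
    (v *m At t) 0 j = \sum_b v 0 (enum_rank b) * (M b (enum_val j)).[t].
  rewrite mxE (reindex_onto (@enum_rank B) (@enum_val B _)) /=; last first.
    by move=> r _; rewrite enum_valK.
  rewrite (eq_bigl xpredT) => [|r]; last by rewrite enum_rankK eqxx.
  by apply: eq_bigr => b _; rewrite !mxE enum_rankK.
have /row_freeP[X AX] : row_free (At 0).
  apply: inj_row_free => v v0; apply/rowP => i; rewrite mxE -(enum_valK i).
  apply: (inj0 (fun b => v 0 (enum_rank b))) => c.
  by have := mulA 0 v (enum_rank c); rewrite enum_rankK v0 mxE.
pose w := \det (A *m map_mx polyC X).
have wE t : w.[t] = \det (At t *m X).
  rewrite -[LHS]/(horner_eval t w) -det_map_mx map_mxM; congr (\det (_ *m _)).
  by apply/matrixP => i j; rewrite !mxE /= /horner_eval hornerC.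
exists w => [|t wt g gt b].
  by apply: contraTneq isT => w0; have := wE 0; rewrite w0 horner0 AX det1 => /eqP;
    rewrite eq_sym oner_eq0.
pose v : 'rV[K]_#|B| := \row_(i < #|B|) g (enum_val i).
have v0 : v *m At t = 0.
  apply/rowP => j; rewrite mulA mxE -[RHS](gt (enum_val j)).
  by apply: eq_bigr => b' _; rewrite mxE enum_rankK.
have v00 : v = 0.
  have u : At t *m X \in unitmx by rewrite unitmxE unitfE -wE.
  by rewrite -[v](mulmxK u) mulmxA v0 !mul0mx.
by have := congr1 (fun u : 'rV_ _ => u 0 (enum_rank b)) v00; rewrite !mxE enum_rankK.
Qed.

Lemma coef_euler (phi : {poly K}) c e :
  ('X * phi^`() - c *: phi)`_e = (e%:R - c) * phi`_e.
Proof.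
rewrite coefB coefXM coefZ coef_deriv mulrBl; congr (_ - _).
by case: e => [|e] /=; rewrite ?mul0r // mulr_natl.
Qed.

(* The Euler operator shifted by an exponent of E removes one term and lowers
   the multiplicity of the root 1 by at most one. *)
Lemma sparse_dvdp_eq0 (E : seq nat) (phi : {poly K}) :
  (forall e, e \notin E -> phi`_e = 0) -> ('X - 1%:P) ^+ size E %| phi -> phi = 0.
Proof.
elim: E phi => [|e0 E IH] phi supp dv.
  by apply/polyP => e; rewrite supp // coef0.
have psi0 : 'X * phi^`() - e0%:R *: phi = 0.
  apply: IH => [e eE|].
    rewrite coef_euler; have [->|ee0] := eqVneq e e0; first by rewrite subrr mul0r.
    by rewrite supp ?mulr0 // inE negb_or ee0.
  case/dvdpP: dv => q phiE; apply: dvdp_sub.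
    apply: dvdp_mull; rewrite phiE derivM; apply: dvdp_add; apply: dvdp_mull.
      by rewrite /= exprS dvdp_mull.
    by rewrite deriv_exp -scaler_nat dvdpZr ?natf_eq0 // dvdp_mull.
  by rewrite -mul_polyC phiE /= exprS !dvdp_mull.
(* The kernel of the operator consists of the multiples of ['X^e0], and such a multiple with root 1
   is zero. *)
have supp1 e : e != e0 -> phi`_e = 0.
  move=> ee0; have := congr1 (fun q : {poly K} => q`_e) psi0.
  rewrite coef_euler coef0 => /eqP.
  rewrite mulf_eq0 subr_eq0 => /orP[/eqP/(natf_inj charK) h|/eqP//].
  by rewrite h eqxx in ee0.
have phiE : phi = phi`_e0 *: 'X^e0.
  apply/polyP => e; rewrite coefZ coefXn; case: eqP => [->|/eqP/supp1->].
    by rewrite mulr1.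
  by rewrite mulr0.
have : root phi 1.
  rewrite root_factor_theorem /=; apply: dvdp_trans dv => /=.
  by rewrite exprS dvdp_mulr.
rewrite rootE phiE hornerZ hornerXn expr1n mulr1 => /eqP->.
by rewrite scale0r.
Qed.

Lemma prod_XsubC_dvdp (I : eqType) (r : seq I) (x : I -> K) (mu : I -> nat) phi :
  uniq r -> injective x -> (forall j, ('X - (x j)%:P) ^+ mu j %| phi) ->
  \prod_(j <- r) ('X - (x j)%:P) ^+ mu j %| phi.
Proof.
move=> + injx dv; elim: r => [|j r IH] /=; first by rewrite big_nil dvd1p.
case/andP => jr ur; rewrite big_cons Gauss_dvdp ?dv ?IH //.
rewrite coprimep_expl // big_seq; elim/big_rec: _ => [|k p kr cop].
  by rewrite coprimep1.
rewrite coprimepMr cop andbT coprimep_expr // coprimep_XsubC root_XsubC.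
by apply: contraNneq jr => /injx <-.
Qed.

(* For x_j = 1 + u * j the remainders of the monomials modulo the product depend
   polynomially on u, and u = 0 is the case of a single point. *)
Lemma sparse_points_one N (E : seq nat) (mu : 'I_N -> nat) :
  uniq E -> (size E <= \sum_j mu j)%N ->
  exists2 w : {poly K}, w != 0 & forall u, w.[u] != 0 -> forall phi : {poly K},
    (forall e, e \notin E -> phi`_e = 0) ->
    \prod_(j < N) ('X - (1 + u * j%:R)%:P) ^+ mu j %| phi -> phi = 0.
Proof.
move=> uE szE.
pose P (u : K) : {poly K} := \prod_(j < N) ('X - (1 + u * j%:R)%:P) ^+ mu j.
pose PP : {poly {poly K}} := \prod_(j < N) ('X - (1 + 'X * j%:R%:P)%:P) ^+ mu j.
have PPmonic : PP \is monic by apply: monic_prod => j _; rewrite monic_exp ?monicXsubC.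
have mapP u : map_poly (horner_eval u) PP = P u.
  rewrite rmorph_prod; apply: eq_bigr => j _.
  rewrite rmorphXn rmorphB /= map_polyX map_polyC /=; congr (('X - _%:P) ^+ _).
  by rewrite /horner_eval !hornerE.
have Pmonic u : P u \is monic by apply: monic_prod => j _; rewrite monic_exp ?monicXsubC.
have szP u : size (P u) = size PP.
  rewrite -mapP size_map_poly_id0 // (monicP PPmonic) /=.
  by rewrite /horner_eval hornerC oner_neq0.
(* [PP] is monic, so remainders exist over the ring [{poly K}]; evaluated at [u] they are remainders
   modulo [P u]. *)
pose rem e := Pdiv.Ring.rmodp ('X^e) PP.
pose B := 'I_(size E); pose C := 'I_(size PP).
pose M (b : B) (c : C) := (rem (nth 0 E b))`_c.
pose poly_of (g : B -> K) : {poly K} := \sum_b g b *: 'X^(nth 0 E b).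
pose rem_of (u : K) (g : B -> K) : {poly K} :=
  \sum_b g b *: map_poly (horner_eval u) (rem (nth 0 E b)).
have rem_dvd u g : P u %| poly_of g - rem_of u g.
  rewrite -sumrB; elim/big_rec: _ => [|b p _]; first by rewrite dvdp0.
  move=> dp; apply: dvdp_add dp; rewrite -scalerBr -mul_polyC; apply: dvdp_mull.
  have := congr1 (map_poly (horner_eval u))
    (Pdiv.RingMonic.rdivp_eq PPmonic 'X^(nth 0 E b)).
  rewrite rmorphXn rmorphD rmorphM /= map_polyX mapP => ->.
  by rewrite -addrA subrr addr0 dvdp_mull.
have coef_rem u g (c : C) : (rem_of u g)`_c = \sum_b g b * (M b c).[u].
  by rewrite coef_sum; apply: eq_bigr => b _; rewrite coefZ coef_map.
have sz_rem u g : (size (rem_of u g) < size PP)%N.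
  rewrite ltnNge; apply/negP => big.
  have PP0 : (0 < size PP)%N by rewrite lt0n size_poly_eq0 monic_neq0.
  have : (size (rem_of u g) <= (size PP).-1)%N.
    apply/leq_sizeP => c hc; rewrite coef_sum big1 // => b _.
    have remc : (rem (nth 0 E b))`_c = 0.
      apply: nth_default; rewrite -ltnS; apply: leq_trans (_ : size PP <= _)%N.
        exact: Pdiv.Ring.ltn_rmodpN0 (monic_neq0 PPmonic).
      by rewrite -(prednK PP0).
    by rewrite coefZ coef_map /= remc /horner_eval horner0 mulr0.
  lia.
have coef_poly g e : e \notin E -> (poly_of g)`_e = 0.
  move=> eE; rewrite coef_sum big1 // => b _; rewrite coefZ coefXn.
  case: eqP => [eb|]; last by rewrite mulr0.
  by move: eE; rewrite eb mem_nth.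
have poly_of0 g : poly_of g = 0 -> forall b, g b = 0.
  move=> g0 b; have := congr1 (fun q : {poly K} => q`_(nth 0 E b)) g0.
  rewrite coef0 coef_sum (bigD1 b) //= coefZ coefXn eqxx mulr1 big1 ?addr0 // => b' b'b.
  rewrite coefZ coefXn nth_uniq //; case: eqP => [bb|]; last by rewrite mulr0.
  by case/eqP: b'b; apply: val_inj.
have [w w0 hw] : exists2 w : {poly K}, w != 0 & forall t, w.[t] != 0 ->
    forall g : B -> K, (forall c, \sum_b g b * (M b c).[t] = 0) -> forall b, g b = 0.
  apply: generic_injective => g hg; apply: poly_of0.
  apply: (@sparse_dvdp_eq0 E) => [e|]; first exact: coef_poly.
  have r0 : rem_of 0 g = 0.
    apply/polyP => c; rewrite coef0; have [cP|cP] := ltnP c (size PP).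
      by rewrite (coef_rem 0 g (Ordinal cP)) hg.
    by rewrite nth_default // ltnW // (leq_trans (sz_rem _ _)).
  have := rem_dvd 0 g; rewrite r0 subr0; apply: dvdp_trans.
  have -> : P 0 = ('X - 1%:P) ^+ \sum_j mu j.
    rewrite expr_sum; apply: eq_bigr => j _; by rewrite mul0r addr0.
  exact: dvdp_exp2l.
exists w => // u wu phi supp dv.
pose g (b : B) := phi`_(nth 0 E b).
have phiE : phi = poly_of g.
  apply/polyP => e; have [eE|eE] := boolP (e \in E); last by rewrite supp ?coef_poly.
  have ie : (index e E < size E)%N by rewrite index_mem.
  rewrite coef_sum (bigD1 (Ordinal ie)) //= coefZ coefXn nth_index // eqxx mulr1.
  rewrite /g nth_index // big1 ?addr0 // => b bi; rewrite coefZ coefXn.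
  case: eqP => [eb|]; last by rewrite mulr0.
  by case/eqP: bi; apply: val_inj; rewrite /= eb index_uniq.
have g0 : forall b, g b = 0.
  apply: hw wu _ _ => c; rewrite -coef_rem.
  suff -> : rem_of u g = 0 by rewrite coef0.
  apply/eqP; apply: contraT => r0.
  have dr : P u %| rem_of u g.
    by rewrite -(@dvdp_subr _ _ (poly_of g)) ?rem_dvd // -phiE.
  by have := dvdp_leq r0 dr; rewrite szP leqNgt sz_rem.
by rewrite phiE /poly_of big1 // => b _; rewrite g0 scale0r.
Qed.

(** The product of the exceptional polynomials of the single rows allows one [u] for all rows. *)
Lemma sparse_points N R (E : nat -> seq nat) (mu : nat -> 'I_N -> nat) :
  (forall r, (r < R)%N -> uniq (E r) /\ (size (E r) <= \sum_j mu r j)%N) ->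
  exists x : 'I_N -> K, forall r, (r < R)%N -> forall phi : {poly K},
    (forall e, e \notin E r -> phi`_e = 0) ->
    (forall j, ('X - (x j)%:P) ^+ mu r j %| phi) -> phi = 0.
Proof.
move=> hE.
have [w w0 hw] : exists2 w : {poly K}, w != 0 & forall u, w.[u] != 0 ->
    forall r, (r < R)%N -> forall phi : {poly K},
    (forall e, e \notin E r -> phi`_e = 0) ->
    \prod_(j < N) ('X - (1 + u * j%:R)%:P) ^+ mu r j %| phi -> phi = 0.
  elim: R hE => [|R IH] hE; first by exists 1; rewrite ?oner_neq0.
  have [|w w0 hw] := IH; first by move=> r rR; apply: hE; apply: ltnW.
  have [uE sE] := hE R (ltnSn R).
  have [w' w'0 hw'] := sparse_points_one uE sE.
  exists (w * w'); first by rewrite mulf_neq0.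
  move=> u; rewrite hornerM mulf_eq0 negb_or => /andP[wu wu'] r.
  by rewrite ltnS leq_eqVlt => /orP[/eqP->|]; [apply: hw'|apply: hw].
(* The factor ['X] excludes [u = 0], where the points coincide. *)
have [u] : exists u, (w * 'X).[u] != 0.
  by apply: poly_nonroot => //; rewrite mulf_neq0 ?polyX_eq0.
rewrite hornerM hornerX mulf_eq0 negb_or => /andP[wu u0].
have injx : injective (fun j : 'I_N => 1 + u * j%:R : K).
  move=> j k /addrI /(mulfI u0) /(natf_inj charK); exact: val_inj.
exists (fun j => 1 + u * j%:R) => // r rR phi supp dv.
by apply: (hw u wu r rR phi supp); apply: prod_XsubC_dvdp => //; apply: index_enum_uniq.
Qed.

End Sparse.

(** * Taylor coefficients and multiplicity *)

Section Shift.
Variables (K : fieldType).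

Lemma shift_dvdp (x : K) m (phi : {poly K}) :
  (forall p, (p < m)%N -> (phi \Po ('X + x%:P))`_p = 0) -> ('X - x%:P) ^+ m %| phi.
Proof.
move=> h; rewrite -(comp_polyXaddC_K phi x) -(poly_take_drop m (phi \Po _)).
have -> : take_poly m (phi \Po ('X + x%:P)) = 0.
  by apply/polyP => p; rewrite coef_take_poly coef0; case: ltnP => // /h.
by rewrite add0r comp_polyM rmorphXn /= comp_polyX dvdp_mull.
Qed.

Lemma coef_addX1n r c : (('X + 1%:P : {poly K}) ^+ r)`_c = 'C(r, c)%:R.
Proof.
rewrite exprD1n coef_sum; have [cr|rc] := leqP c r.
  rewrite (bigD1 (Ordinal (cr : (c < r.+1)%N))) //= coefMn coefXn eqxx big1 ?addr0 //.
  move=> i ic; rewrite coefMn coefXn; case: eqP => [e|]; last by rewrite mul0rn.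
  by case/eqP: ic; apply: val_inj; rewrite /= e.
rewrite bin_small // big1 // => i _; rewrite coefMn coefXn; case: eqP => [e|].
  by have := ltn_ord i; lia.
by rewrite mul0rn.
Qed.

End Shift.

(** * The limit conditions, row by row *)

Section Limit.
Variables (K : fieldType) (charK : [pchar K] =i pred0).

(* Points with j < b lie off the curve, at z = 1; the others on it, at z = 0. *)
Definition row_mult mu b r j :=
  if (j < b)%N then (if (r < mu)%N then mu - r.+1 else mu)%N else (mu - r)%N.

(* Modulo ('X - x j) ^ (mu - r - 1), the relations of index c = r + 1 and c = r
   at a point with z = 1 give first phi mu = 0, then phi r = 0, once the rows
   strictly between r and mu are known to vanish. *)
Lemma limit_rows_eq0 N mu b (x : 'I_N -> K) (phi : nat -> {poly K}) :
  (0 < mu)%N ->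
  (forall r, (r <= mu)%N ->
     (forall j, ('X - (x j)%:P) ^+ row_mult mu b r j %| phi r) -> phi r = 0) ->
  (forall (j : 'I_N) c, (c < mu)%N -> ('X - (x j)%:P) ^+ (mu - c) %|
     \sum_(r < mu.+1) (('X + ((j < b)%N%:R : K)%:P) ^+ r)`_c *: phi r) ->
  forall r, (r <= mu)%N -> phi r = 0.
Proof.
move=> mu0 star dv.
have dvA (j : 'I_N) c : (b <= j)%N -> (c < mu)%N ->
    ('X - (x j)%:P) ^+ (mu - c) %| phi c.
  move=> bj cmu; have := dv j c cmu; rewrite ltnNge bj /= addr0.
  rewrite (bigD1 (Ordinal (ltnW cmu : (c < mu.+1)%N))) //= coefXn eqxx scale1r.
  rewrite big1 ?addr0 // => r rc; rewrite coefXn eq_sym.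
  by rewrite (negbTE (rc : (r : nat) != c)) scale0r.
have dvB (j : 'I_N) c : (j < b)%N -> (c < mu)%N ->
    ('X - (x j)%:P) ^+ (mu - c) %| \sum_(r < mu.+1) 'C(r, c)%:R *: phi r.
  move=> jb cmu; have := dv j c cmu; rewrite jb.
  by under eq_bigr do rewrite coef_addX1n.
(* Descending induction on [r], with [s] as a bound for [mu - r]. *)
have low s r : (r < mu)%N -> (mu - r <= s)%N -> phi r = 0.
  elim: s r => [|s IH] r rmu rs; first lia.
  apply: star => [|j]; first exact: ltnW.
  have phi0 q : (r < q < mu)%N -> phi q = 0 by move=> h; apply: IH; lia.
  rewrite /row_mult; case: ltnP => [jb|bj]; last exact: dvA.
  rewrite rmu; have [rmu1|rmu1] := ltnP r.+1 mu; last first.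
    by rewrite (_ : mu - r.+1 = 0)%N ?expr0 ?dvd1p //; lia.
  have sum_last c : (r <= c)%N -> \sum_(q < mu.+1) 'C(q, c)%:R *: phi q =
      (if c == r then phi r else 0) + 'C(mu, c)%:R *: phi mu.
    move=> rc; rewrite big_ord_recr /=; congr (_ + _).
    rewrite (bigD1 (Ordinal rmu)) //= [X in _ + X]big1 ?addr0 => [|q qr].
      case: eqP => [->|/eqP cr]; first by rewrite binn scale1r.
      by rewrite bin_small ?scale0r // ltn_neqAle eq_sym cr.
    have [qr'|rq] := ltnP q r; first by rewrite bin_small ?scale0r //; lia.
    rewrite phi0 ?scaler0 // ltn_ord andbT ltn_neqAle rq andbT eq_sym.
    exact: qr.
  have dmu : ('X - (x j)%:P) ^+ (mu - r.+1) %| phi mu.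
    have := dvB j r.+1 jb rmu1; rewrite sum_last // gtn_eqF // add0r.
    by rewrite dvdpZr // natf_eq0 // -lt0n bin_gt0 ltnW.
  have := dvB j r jb rmu; rewrite sum_last // eqxx => dsum.
  have : ('X - (x j)%:P) ^+ (mu - r.+1) %| phi r + 'C(mu, r)%:R *: phi mu.
    by apply: dvdp_trans dsum; apply: dvdp_exp2l; lia.
  by rewrite dvdp_addl // -mul_polyC dvdp_mull.
move=> r; rewrite leq_eqVlt => /orP[/eqP->|rmu]; last exact: low (leqnn _).
apply: star => // j; rewrite /row_mult ltnn; case: ltnP => [jb|bj].
  have := dvB j 0 jb mu0; rewrite subn0 big_ord_recr /= bin0 scale1r big1 ?add0r //.
  by move=> q _; rewrite (low (mu - q)%N) ?scaler0.
by rewrite subnn expr0 dvd1p.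
Qed.

End Limit.

(** * Degeneration of plane forms to the curve [y = x ^ k] *)

Section Planar.
Variables (K : fieldType) (charK : [pchar K] =i pred0).
Variables (k nu d N b : nat) (P : nat -> seq (nat * nat)).
Hypothesis k_gt0 : (0 < k)%N.
(** On the curve [y = x ^ k] the monomial with exponents [p] restricts to the power [p.1 + k * p.2]
    of [x]; within a row these powers have to be distinct. *)
Hypothesis P_uniq : forall r, (r <= nu.+1)%N -> uniq [seq (p.1 + k * p.2)%N | p <- P r].
Hypothesis P_deg : forall r, (r <= nu.+1)%N ->
  forall p, p \in P r -> (p.1 + p.2 + k * r <= nu + d)%N.
Hypothesis P_size : forall r, (r <= nu.+1)%N ->
  (size (P r) <= \sum_(j < N) row_mult nu.+1 b r j)%N.

Let D := {r : 'I_nu.+2 & 'I_(size (P r))}.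
Let rw (e : D) : nat := tag e.
Let pr (e : D) : nat * nat := nth (0, 0)%N (P (tag e)) (tagged e).

Let pr_mem e : pr e \in P (rw e).
Proof. by rewrite mem_nth. Qed.

Let rw_leq e : (rw e <= nu.+1)%N.
Proof. by rewrite -ltnS ltn_ord. Qed.

Let i0 : 'I_3 := Ordinal (isT : (0 < 3)%N).
Let i1 : 'I_3 := Ordinal (isT : (1 < 3)%N).
Let i2 : 'I_3 := Ordinal (isT : (2 < 3)%N).

(* The form whose affine equation is (y - x ^ k) ^ r * x ^ p.1 * y ^ p.2. *)
Let F (e : D) : {mpoly K[3]} :=
  'X_i0 ^+ (nu + d - ((pr e).1 + (pr e).2 + k * rw e)) *
  ('X_i2 * 'X_i0 ^+ k.-1 - 'X_i1 ^+ k) ^+ rw e * 'X_i1 ^+ (pr e).1 * 'X_i2 ^+ (pr e).2.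

Let X_homog (i : 'I_3) m : ('X_i : {mpoly K[3]}) ^+ m \is m.-homog.
Proof.
have h : ('X_i : {mpoly K[3]}) \is 1.-homog by rewrite dhomogX /= mdeg1.
by have := dhomogMn m h; rewrite mul1n.
Qed.

Let F_homog e : F e \is (nu + d).-homog.
Proof.
have hz : 'X_i2 * 'X_i0 ^+ k.-1 - 'X_i1 ^+ k \is [in K[3], k.-homog].
  apply: rpredB; last exact: X_homog.
  have := dhomogM (X_homog i2 1) (X_homog i0 k.-1).
  by rewrite expr1 add1n prednK.
have := dhomogM (dhomogM (dhomogM (X_homog i0 (nu + d - ((pr e).1 + (pr e).2 + k * rw e)))
  (dhomogMn (rw e) hz)) (X_homog i1 (pr e).1)) (X_homog i2 (pr e).2).
have := P_deg (rw_leq e) (pr_mem e); rewrite /F => le.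
have deg a c q m : (a + c + q <= m)%N -> (m - (a + c + q) + q + a + c = m)%N by lia.
by rewrite (deg _ _ _ _ le).
Qed.

Let z (j : 'I_N) : K := (j < b)%N%:R.

(* The coefficient of index (c, p) of the equation of F e at a point near
   (x j, z j), where y - x ^ k has been replaced by t * z; the common factor
   t ^ rw e is removed and t is the variable of the result. *)
Let M (x : 'I_N -> K) (e : D) (q : 'I_N * 'I_nu.+1 * 'I_nu.+1) : {poly K} :=
  let: (j, c, p) := q in
  if (p + c <= nu)%N then
    \sum_(s < (pr e).2.+1)
      ((('X + (z j)%:P) ^+ (rw e + s))`_c *
       (('X + (x j)%:P) ^+ ((pr e).1 + k * ((pr e).2 - s)))`_p
         *+ 'C((pr e).2, s)) *: 'X^s
  else 0.

(* At t = 0 each row contributes its own power of z times a sparse polynomial in x. *)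
Let M0_inj (x : 'I_N -> K) :
  (forall r, (r < nu.+2)%N -> forall phi : {poly K},
    (forall e, e \notin [seq (p.1 + k * p.2)%N | p <- P r] -> phi`_e = 0) ->
    (forall j, ('X - (x j)%:P) ^+ row_mult nu.+1 b r j %| phi) -> phi = 0) ->
  forall g : D -> K, (forall q, \sum_e g e * (M x e q).[0] = 0) -> forall e, g e = 0.
Proof.
move=> star g gM.
pose ex (e : D) := ((pr e).1 + k * (pr e).2)%N.
pose phi r : {poly K} := \sum_(e | rw e == r) g e *: 'X^(ex e).
have ex_mem e : ex e \in [seq (p.1 + k * p.2)%N | p <- P (rw e)].
  by apply/mapP; exists (pr e).
have ex_inj e e' : rw e = rw e' -> ex e = ex e' -> e = e'.
  case: e e' => [r l] [r' l']; rewrite /rw /= => /val_inj rr.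
  case: _ / rr l' => l' /eqP; rewrite /ex /pr /=.
  have /= hl := nth_map (0, 0)%N 0%N (fun p : nat * nat => (p.1 + k * p.2)%N).
  rewrite -!hl // nth_uniq ?size_map //; last by apply: P_uniq; rewrite -ltnS.
  by move=> /eqP/val_inj->.
have phi0 : forall r, (r <= nu.+1)%N -> phi r = 0.
  apply: (limit_rows_eq0 charK (N := N) (b := b) (x := x)) => // [r rnu|j c cnu].
    apply: star => // e eP; rewrite coef_sum big1 // => e' /eqP er.
    rewrite coefZ coefXn; case: eqP => [ee|]; last by rewrite mulr0.
    by move: eP; rewrite ee -er ex_mem.
  apply: shift_dvdp => p pc.
  have pnu : (p < nu.+1)%N by lia.
  rewrite -[RHS](gM (j, Ordinal cnu, Ordinal pnu)).
  rewrite raddf_sum coef_sum /=.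
  transitivity (\sum_(r < nu.+2) \sum_(e | rw e == r)
      g e * (M x e (j, Ordinal cnu, Ordinal pnu)).[0]).
    apply: eq_bigr => r _; rewrite /phi scaler_sumr raddf_sum coef_sum /=.
    apply: eq_bigr => e /eqP er; rewrite (_ : (p + c <= nu)%N); last by lia.
    (* At 0 only the term [s = 0] survives: [y] is replaced by [x ^ k]. *)
    rewrite horner_sum big_ord_recl big1 /= => [|s _]; last first.
      by rewrite hornerZ hornerXn expr0n mulr0.
    rewrite addr0 hornerZ hornerXn expr0 mulr1 bin0 mulr1n addn0 subn0 -er.
    by rewrite !linearZ /= !coefZ rmorphXn /= comp_polyX mulrCA.
  rewrite (exchange_big_dep predT) //=; apply: eq_bigr => e _.
  by rewrite (big_pred1 (tag e)).
move=> e; have := congr1 (fun q : {poly K} => q`_(ex e)) (phi0 _ (rw_leq e)).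
rewrite coef0 coef_sum (bigD1 e) //= coefZ coefXn eqxx mulr1 big1 ?addr0 // => e' /andP[/eqP er ee].
rewrite coefZ coefXn; case: eqP => [h|]; last by rewrite mulr0.
by case/eqP: ee; apply: ex_inj.
Qed.

(** If a combination of the [F e] vanishes to order [nu + 1] at points close to the curve, its
    rescaled coefficients solve the system [M] at some [t]. This system is injective at 0, hence at
    a general nonzero [t]. *)
Lemma planar_rank : exists L : 'M[K]_(N, 3),
  (\sum_(r < nu.+2) size (P r) <= \rank (power_mx d nu L))%N.
Proof.
have [|x star] := @sparse_points K charK N nu.+2
    (fun r => [seq (p.1 + k * p.2)%N | p <- P r]) (row_mult nu.+1 b).
  by move=> r rnu; rewrite size_map; split; [apply: P_uniq|apply: P_size].
have [w w0 hw] := generic_injective (M0_inj star).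
have [t] : exists t, (w * 'X).[t] != 0.
  by apply: poly_nonroot => //; rewrite mulf_neq0 ?polyX_eq0.
rewrite hornerM hornerX mulf_eq0 negb_or => /andP[wt t0].
pose L : 'M[K]_(N, 3) := \matrix_(j, q) nth 0 [:: 1; x j; x j ^+ k + t * z j] q.
exists L.
have -> : (\sum_(r < nu.+2) size (P r) = #|{: {r : 'I_nu.+2 & 'I_(size (P r))}}|)%N.
  by rewrite card_tagged sumnE big_map big_enum /=; apply: eq_bigr => r _; rewrite card_ord.
apply: (rank_power_mx (F := F)) => g van e.
have gt0 : g e * t ^+ rw e = 0; last first.
  by move/eqP: gt0; rewrite mulf_eq0 expf_eq0 (negbTE t0) andbF orbF => /eqP.
apply: (hw t wt (fun e => g e * t ^+ rw e)) => -[[j c] p]; rewrite /M.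
have [pc|_] := leqP (p + c)%N nu; last by rewrite big1 // => e' _; rewrite horner0 mulr0.
(* The inner variable moves [x] and the outer one moves [z]; on this arc [y - x ^ k] equals
   [t * ZZ]. *)
pose XX : {poly {poly K}} := ('X + (x j)%:P)%:P.
pose ZZ : {poly {poly K}} := 'X + (z j)%:P%:P.
pose y (q : 'I_3) : {poly {poly K}} := nth 0 [:: 1; XX; XX ^+ k + t%:P%:P * ZZ] q.
have ya q : (y q)`_0`_0 = row j L 0 q.
  rewrite !mxE /y; case: q => [[|[|[|//]]] hq] /=; rewrite -!horner_coef0.
  - by rewrite !hornerE.
  - by rewrite !hornerE.
  by rewrite !(hornerD, horner_exp, hornerM, hornerC, hornerX) !add0r.
have hG : \sum_e g e *: F e \is (nu + d).-homog.
  by apply: rpred_sum => e' _; apply: dhomogZ.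
have := vanishing_coef charK hG (van j) ya pc.
have -> : mmap (polyC \o polyC) y (\sum_e g e *: F e) =
   \sum_e (g e)%:P%:P * ((t%:P%:P * ZZ) ^+ rw e * XX ^+ (pr e).1 *
       (XX ^+ k + t%:P%:P * ZZ) ^+ (pr e).2).
  rewrite raddf_sum; apply: eq_bigr => e' _; rewrite /= mmapZ /F /=.
  rewrite !rmorphM !rmorphXn rmorphB rmorphM !rmorphXn /= !mmapX !mmap1U /y /=.
  by rewrite !expr1n mulr1 mul1r addrAC subrr add0r.
rewrite !coef_sum => van0; rewrite -[RHS]van0; apply: eq_bigr => e' _.
rewrite !coefCM -mulrA; congr (_ * _).
have ZE m : ZZ ^+ m = map_poly polyC (('X + (z j)%:P) ^+ m).
  by rewrite rmorphXn rmorphD /= map_polyX map_polyC.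
rewrite exprDn mulr_sumr !coef_sum horner_sum mulr_sumr; apply: eq_bigr => s _.
have -> : (t%:P%:P * ZZ) ^+ rw e' * XX ^+ (pr e').1 *
    ((XX ^+ k) ^+ ((pr e').2 - s) * (t%:P%:P * ZZ) ^+ s *+ 'C((pr e').2, s)) =
  (t ^+ (rw e' + s))%:P%:P * (ZZ ^+ (rw e' + s) *
    (('X + (x j)%:P) ^+ ((pr e').1 + k * ((pr e').2 - s)))%:P) *+ 'C((pr e').2, s).
  rewrite mulrnAr; congr (_ *+ _).
  rewrite -exprM [X in _ * X]mulrC mulrACA -!exprD exprMn -mulrA.
  rewrite [(t ^+ _)%:P]rmorphXn [(_ ^+ _)%:P in RHS]rmorphXn.
  by congr (_ * (_ * _)); rewrite /XX rmorphXn.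
rewrite !coefMn !coefCM coefMC ZE coef_map /= coefCM hornerZ hornerXn.
by rewrite mulrnAl mulrnAr; congr (_ *+ _); rewrite [_ * t ^+ s]mulrC mulrA -exprD.
Qed.

End Planar.

(** * Forms in space along the curve [(1 : x : x ^ 2 : x ^ 4)] *)

Section Spatial.
Variables (K : fieldType) (charK : [pchar K] =i pred0).
Variables (nu d N : nat) (P : nat -> seq (nat * nat * nat)).
(** The power of [x] to which the monomial with exponents [p] restricts on the curve. *)
Let expo (p : nat * nat * nat) := (p.1.1 + 2 * p.1.2 + 4 * p.2)%N.
Hypothesis P_uniq : forall r, (r <= nu)%N -> uniq (map expo (P r)).
Hypothesis P_deg : forall r, (r <= nu)%N ->
  forall p, p \in P r -> (p.1.1 + p.1.2 + p.2 + 2 * r <= nu + d)%N.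
Hypothesis P_size : forall r, (r <= nu)%N -> (size (P r) <= N * (nu.+1 - r))%N.

Let D := {r : 'I_nu.+1 & 'I_r.+1 * 'I_(size (P r))}%type.
Let rw (e : D) : nat := tag e.
Let r2 (e : D) : nat := (tagged e).1.
Let pr (e : D) : nat * nat * nat := nth (0, 0, 0)%N (P (tag e)) (tagged e).2.

Let pr_mem e : pr e \in P (rw e).
Proof. by rewrite mem_nth. Qed.

Let rw_leq e : (rw e <= nu)%N.
Proof. by rewrite -ltnS ltn_ord. Qed.

Let r2_leq e : (r2 e <= rw e)%N.
Proof. by rewrite -ltnS ltn_ord. Qed.

Let D_inj e e' : rw e = rw e' -> r2 e = r2 e' -> expo (pr e) = expo (pr e') -> e = e'.
Proof.
case: e e' => [r [s l]] [r' [s' l']]; rewrite /rw /= => /val_inj rr.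
case: _ / rr s' l' => s' l'; rewrite /r2 /pr /= => /val_inj -> /eqP.
have /= hl := nth_map (0, 0, 0)%N 0%N expo.
rewrite -!hl // nth_uniq ?size_map //; last by apply: P_uniq; rewrite -ltnS.
by move=> /eqP/val_inj->.
Qed.

Let i0 : 'I_4 := Ordinal (isT : (0 < 4)%N).
Let i1 : 'I_4 := Ordinal (isT : (1 < 4)%N).
Let i2 : 'I_4 := Ordinal (isT : (2 < 4)%N).
Let i3 : 'I_4 := Ordinal (isT : (3 < 4)%N).

(** In affine coordinates, [(y - x ^ 2) ^ (rw e - r2 e) * (z - y ^ 2) ^ r2 e] times a monomial; the
    power of ['X_i0] in front homogenizes. *)
Let F (e : D) : {mpoly K[4]} :=
  'X_i0 ^+ (nu + d - ((pr e).1.1 + (pr e).1.2 + (pr e).2 + 2 * rw e)) *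
  ('X_i2 * 'X_i0 - 'X_i1 ^+ 2) ^+ (rw e - r2 e) * ('X_i3 * 'X_i0 - 'X_i2 ^+ 2) ^+ r2 e *
  'X_i1 ^+ (pr e).1.1 * 'X_i2 ^+ (pr e).1.2 * 'X_i3 ^+ (pr e).2.

Let X_homog (i : 'I_4) m : ('X_i : {mpoly K[4]}) ^+ m \is m.-homog.
Proof.
have h : ('X_i : {mpoly K[4]}) \is 1.-homog by rewrite dhomogX /= mdeg1.
by have := dhomogMn m h; rewrite mul1n.
Qed.

Let F_homog e : F e \is (nu + d).-homog.
Proof.
have hz (i j : 'I_4) : 'X_i * 'X_i0 - 'X_j ^+ 2 \is [in K[4], 2.-homog].
  by apply: rpredB; [exact: dhomogM (X_homog i 1) (X_homog i0 1)|exact: X_homog].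
have := dhomogM (dhomogM (dhomogM (dhomogM (dhomogM (X_homog i0
    (nu + d - ((pr e).1.1 + (pr e).1.2 + (pr e).2 + 2 * rw e)))
  (dhomogMn (rw e - r2 e) (hz i2 i1))) (dhomogMn (r2 e) (hz i3 i2)))
  (X_homog i1 (pr e).1.1)) (X_homog i2 (pr e).1.2)) (X_homog i3 (pr e).2).
have := P_deg (rw_leq e) (pr_mem e); have := r2_leq e; rewrite /F => le2 le.
have deg a b c q s m : (a + b + c + 2 * q <= m -> s <= q ->
  m - (a + b + c + 2 * q) + 2 * (q - s) + 2 * s + a + b + c = m)%N by lia.
by rewrite (deg _ _ _ _ _ _ le le2).
Qed.

(** The points lie on the curve itself, so the rows can be eliminated one at a time: once the rows
    below [n] vanish, the terms of order [n] across the curve involve row [n] only. *)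
Lemma spatial_rank : exists L : 'M[K]_(N, 4),
  (\sum_(r < nu.+1) r.+1 * size (P r) <= \rank (power_mx d nu L))%N.
Proof.
have [|x star] := @sparse_points K charK N nu.+1
    (fun r => map expo (P r)) (fun r _ => nu.+1 - r)%N.
  move=> r rnu; rewrite size_map; split; first exact: P_uniq.
  by rewrite sum_nat_const card_ord P_size.
pose L : 'M[K]_(N, 4) := \matrix_(j, q) nth 0 [:: 1; x j; x j ^+ 2; x j ^+ 4] q.
exists L.
have -> : (\sum_(r < nu.+1) r.+1 * size (P r) =
    #|{: {r : 'I_nu.+1 & 'I_r.+1 * 'I_(size (P r))}}|)%N.
  rewrite card_tagged sumnE big_map big_enum /=; apply: eq_bigr => r _.
  by rewrite card_prod !card_ord.
apply: (rank_power_mx (F := F)) => g van.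
suff low n e : (rw e < n)%N -> g e = 0 by move=> e; apply: low (ltnSn _).
elim: n e => [//|n IH] e0; rewrite ltnS leq_eqVlt => /orP[/eqP rwn|]; last exact: IH.
have nnu : (n <= nu)%N by rewrite -rwn.
(* The arcs with local coordinates (z, s * z), for all s, separate the rows whose
   exponents (r1, r2) have the same sum n. *)
pose psi s : {poly K} := \sum_(e | rw e == n) (g e * s ^+ r2 e) *: 'X^(expo (pr e)).
have psi0 s : psi s = 0.
  apply: (star n) => // [e eP|j].
    rewrite coef_sum big1 // => e' /eqP er; rewrite coefZ coefXn.
    case: eqP => [ee|]; last by rewrite mulr0.
    by move: eP; rewrite ee -er map_f.
  apply: shift_dvdp => p pn.
  have pc : (p + n <= nu)%N by lia.
  pose XX : {poly {poly K}} := ('X + (x j)%:P)%:P.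
  (* Along this arc the two quadrics become ['X] and [s * 'X]. *)
  pose y (q : 'I_4) : {poly {poly K}} :=
    nth 0 [:: 1; XX; XX ^+ 2 + 'X; (XX ^+ 2 + 'X) ^+ 2 + s%:P%:P * 'X] q.
  have ya q : (y q)`_0`_0 = row j L 0 q.
    rewrite !mxE /y; case: q => [[|[|[|[|//]]]] hq] /=; rewrite -!horner_coef0.
    - by rewrite !hornerE.
    - by rewrite !hornerE.
    - by rewrite !(hornerD, horner_exp, hornerM, hornerC, hornerX) !add0r addr0.
    rewrite !(hornerD, horner_exp, hornerM, hornerC, hornerX).
    by rewrite !(add0r, addr0, mulr0) -exprM.
  have hG : \sum_e g e *: F e \is (nu + d).-homog.
    by apply: rpred_sum => e' _; apply: dhomogZ.
  have := vanishing_coef charK hG (van j) ya pc.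
  have -> : mmap (polyC \o polyC) y (\sum_e g e *: F e) =
     \sum_e (g e * s ^+ r2 e)%:P%:P * (XX ^+ (pr e).1.1 * (XX ^+ 2 + 'X) ^+ (pr e).1.2 *
       ((XX ^+ 2 + 'X) ^+ 2 + s%:P%:P * 'X) ^+ (pr e).2 * 'X^(rw e)).
    rewrite raddf_sum; apply: eq_bigr => e' _; rewrite /= mmapZ /F /=.
    rewrite !(rmorphM, rmorphXn, rmorphB) /= !mmapX !mmap1U /y /=.
    rewrite !mulr1 !expr1n mul1r addrAC subrr add0r addrAC subrr add0r.
    rewrite -[RHS]mulrA; congr (_ * _); rewrite exprMn -[in RHS](subnK (r2_leq e')) exprD.
    by ring.
  rewrite !coef_sum => van0; rewrite -[RHS]van0.
  rewrite raddf_sum coef_sum /= big_mkcond; apply: eq_bigr => e _.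
  (* Rows above [n] have too high an order in the outer variable, and rows below [n] vanish by
     induction. *)
  rewrite coefCM coefMXn; have [lt|gt|->] := ltngtP (rw e) n; last first.
  - rewrite subnn coefCM linearZ /= coefZ; congr (_ * _).
    rewrite -horner_coef0.
    rewrite !(hornerD, horner_exp, hornerM, hornerC, hornerX) !(addr0, mulr0).
    by rewrite rmorphXn /= comp_polyX -!exprM -!exprD mulnA.
  - by rewrite mulr0 coef0.
  - by rewrite (IH e lt) mul0r !mul0r coef0.
(* At a fixed power of [x], the coefficient of [psi s] is a polynomial in [s] vanishing at every
   scalar, hence zero. *)
pose q : {poly K} :=
  \sum_(e | (rw e == n) && (expo (pr e) == expo (pr e0))) g e *: 'X^(r2 e).
have q0 : q = 0.
  apply/eqP; apply: contraT => /(poly_nonroot charK) [s /eqP[]].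
  have := congr1 (fun q : {poly K} => q`_(expo (pr e0))) (psi0 s).
  rewrite coef0 => <-; rewrite coef_sum horner_sum.
  rewrite [RHS](bigID (fun e => expo (pr e) == expo (pr e0))) /=.
  rewrite [X in _ = _ + X]big1 ?addr0 => [|e /andP[_ /negbTE ee]]; last first.
    by rewrite coefZ coefXn eq_sym ee mulr0.
  apply: eq_bigr => e /andP[_ /eqP->].
  by rewrite coefZ coefXn eqxx mulr1 hornerZ hornerXn.
have := congr1 (fun q : {poly K} => q`_(r2 e0)) q0.
rewrite coef0 coef_sum (bigD1 e0) ?rwn ?eqxx //= coefZ coefXn eqxx mulr1.
rewrite big1 ?addr0 // => e /andP[/andP[/eqP er /eqP ex] ee].
rewrite coefZ coefXn; case: eqP => [h|]; last by rewrite mulr0.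
by case/eqP: ee; apply: D_inj; rewrite ?er.
Qed.

End Spatial.

(** * Counting conditions and monomials by rows *)

Section Count.
Local Open Scope nat_scope.

Lemma bin2_double n : 2 * 'C(n, 2) = n * n.-1.
Proof. by elim: n => [//|n IH]; rewrite binS bin1 mulnDr IH; case: n {IH} => [|n] /=; lia. Qed.

(** Doubling avoids a division, and [k <= n.+1] keeps the subtractions exact. *)
Lemma sum_subn k n : k <= n.+1 -> 2 * (\sum_(a < k) (n - a)) + k * k.-1 = 2 * (k * n).
Proof.
elim: k => [|k IH] kn; first by rewrite big_ord0.
have := IH (ltnW kn); rewrite big_ord_recr /=; move: (\sum_(_ < _) _) => s.
by case: k kn {IH} => [|k] kn /=; lia.
Qed.

(** Moving [b] points off the curve takes [b] conditions from each row below [mu], and row [mu]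
    collects all [b * mu] of them. *)
Lemma sum_row_mult N b mu r : b <= N ->
  \sum_(j < N) row_mult mu b r j =
  if r < mu then N * (mu - r) - b else b * mu + (N - b) * (mu - r).
Proof.
move=> bN; transitivity (b * (if r < mu then mu - r.+1 else mu) + (N - b) * (mu - r)).
  rewrite -[in LHS](subnKC bN) big_split_ord /=; congr (_ + _).
    rewrite (eq_bigr (fun=> if r < mu then mu - r.+1 else mu)) ?sum_nat_const ?card_ord //.
    by move=> j _; rewrite /row_mult ltn_ord.
  rewrite (eq_bigr (fun=> mu - r)) ?sum_nat_const ?card_ord //.
  by move=> j _; rewrite /row_mult ltnNge leq_addr.
by case: ltnP => [rmu|//]; nia.
Qed.

(** With [A = k * r + a] this is a single sum of [i.+1 - A], where [A > i] contributes zero by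
    truncation. The value is the number of monomials of degree [i] in three variables: the rows
    exhaust all forms. *)
Lemma sum_rows k R i : i < k * R ->
  \sum_(r < R) \sum_(a < k) (i.+1 - (k * r + a)) = 'C(i.+2, 2).
Proof.
move=> iR; have -> : \sum_(r < R) \sum_(a < k) (i.+1 - (k * r + a)) =
    \sum_(A < k * R) (i.+1 - A).
  elim: R {iR} => [|R IH]; first by rewrite muln0 !big_ord0.
  by rewrite big_ord_recr /= IH mulnSr big_split_ord.
have -> : \sum_(A < k * R) (i.+1 - A) = \sum_(A < i.+1) (i.+1 - A).
  rewrite -(subnKC iR) big_split_ord /= [X in _ + X]big1 ?addn0 // => A _; lia.
have := @sum_subn i.+1 i.+1 (leqnSn _); have := bin2_double i.+2; rewrite /=; lia.
Qed.

(** This is the number of conditions for order [mu] at a point of space, sorted by the total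
    exponent [r] of the two quadrics. *)
Lemma sum_antidiag mu : \sum_(r < mu) r.+1 * (mu - r) = 'C(mu.+2, 3).
Proof.
elim: mu => [|mu IH]; first by rewrite big_ord0.
rewrite binS -IH big_ord_recr /= subSnn muln1.
have -> : \sum_(r < mu) r.+1 * (mu.+1 - r) = \sum_(r < mu) r.+1 * (mu - r) + \sum_(r < mu) r.+1.
  by rewrite -big_split; apply: eq_bigr => r _ /=; have := ltn_ord r; nia.
rewrite -addnA; congr (_ + _).
have -> : \sum_(r < mu) r.+1 = 'C(mu.+1, 2).
  elim: (mu) => [|m IHm]; first by rewrite big_ord0.
  by rewrite big_ord_recr /= IHm [RHS]binS bin1.
by rewrite [RHS]binS bin1.
Qed.

(* The number of (a, b, c) with a, b < 2 and a + b + c < n. *)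
Definition cube_count n := n + 2 * n.-1 + n.-2.

(** The right side is the dimension of the forms of degree [i] in four variables modulo a
    quadric. *)
Lemma sum_cube_count1 i R : i < 2 * R ->
  \sum_(r < R) cube_count (i.+1 - 2 * r) = i.+1 * i.+1.
Proof.
elim/ltn_ind: i R => i IH [|R] iR; first lia.
rewrite big_ord_recl muln0 subn0.
case: i IH iR => [|[|i]] IH iR.
- by rewrite big1 // => r _; rewrite lift0 /cube_count; lia.
- by rewrite big1 // => r _; rewrite lift0 /cube_count; lia.
rewrite (eq_bigr (fun r : 'I_R => cube_count (i.+1 - 2 * r))) => [|r _].
  have iR' : i < 2 * R by move: iR; clear; lia.
  have e := IH i (leqnSn _) R iR'.
  rewrite e.
  rewrite /cube_count /=; clear; lia.
by rewrite lift0; congr cube_count; lia.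
Qed.

(** The right side counts the monomials of degree [i] in four variables. Removing the row [r = 0]
    lowers [i] by 2, and the new weight [r.+2] splits into [r.+1] and 1. *)
Lemma sum_cube_count i R : i < 2 * R ->
  \sum_(r < R) r.+1 * cube_count (i.+1 - 2 * r) = 'C(i.+3, 3).
Proof.
elim/ltn_ind: i R => i IH [|R] iR; first lia.
rewrite big_ord_recl muln0 subn0 mul1n.
case: i IH iR => [|[|i]] IH iR.
- by rewrite big1 // => r _; rewrite lift0 /cube_count; lia.
- by rewrite big1 // => r _; rewrite lift0 /cube_count; lia.
rewrite (eq_bigr (fun r : 'I_R => r.+1 * cube_count (i.+1 - 2 * r) +
    cube_count (i.+1 - 2 * r))); last first.
  move=> r _; rewrite lift0; have -> : i.+3 - 2 * r.+1 = i.+1 - 2 * r by clear; lia.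
  by rewrite [LHS]mulSn addnC.
have iR' : i < 2 * R by move: iR; clear; lia.
have e := IH i (leqnSn _) R iR'.
rewrite big_split /= e sum_cube_count1 //.
rewrite [in RHS]binS [in RHS]binS.
have := bin2_double i.+4; have := bin2_double i.+3; rewrite /cube_count /=; lia.
Qed.

End Count.

(** * Maximal rank of Psi_nu for [k ^ 2] plane points and 8 space points *)

Section Points.
Variables (K : fieldType) (charK : [pchar K] =i pred0).

Definition planar_exps k i r : seq (nat * nat) :=
  [seq (a, c) | a <- iota 0 k, c <- iota 0 (i.+1 - (k * r + a))].

Lemma size_planar_exps k i r :
  size (planar_exps k i r) = (\sum_(a < k) (i.+1 - (k * r + a)))%N.
Proof.
rewrite size_allpairs_dep sumnE big_map -{1}[k]subn0 -/(index_iota 0 k) big_mkord.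
by apply: eq_bigr => a _; rewrite size_iota.
Qed.

Lemma planar_exps_mem k i r p : p \in planar_exps k i r ->
  (p.1 < k)%N /\ (p.1 + p.2 + k * r <= i)%N.
Proof.
by case/allpairsPdep => a [c [+ + ->]] /=; rewrite !mem_iota; lia.
Qed.

Lemma planar_exps_uniq k i r : (0 < k)%N ->
  uniq [seq (p.1 + k * p.2)%N | p <- planar_exps k i r].
Proof.
move=> k0; rewrite map_inj_in_uniq.
  apply: allpairs_uniq_dep => [|a _|[a c] [a' c'] _ _ /= [-> ->]] //; exact: iota_uniq.
move=> [a c] [a' c'] /planar_exps_mem [/= ak _] /planar_exps_mem [/= ak' _] e.
have /= := congr1 (modn^~ k) e; rewrite !(addnC _ (k * _)%N) !(mulnC k) !modnMDl.
rewrite !modn_small // => aa; move: e; rewrite aa => /addnI /eqP.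
by rewrite eqn_pmul2l // => /eqP->.
Qed.

(** Each row is cut down to its number of conditions before [planar_rank] is applied. *)
Lemma planar_rank_min k nu d b : (0 < k)%N -> (b <= k ^ 2)%N ->
  exists L : 'M[K]_(k ^ 2, 3),
    (\sum_(r < nu.+2) minn (\sum_(a < k) ((nu + d).+1 - (k * r + a)))
        (if (r < nu.+1)%N then k ^ 2 * (nu.+1 - r) - b else b * nu.+1) <=
     \rank (power_mx d nu L))%N.
Proof.
move=> k0 bN.
pose m r := (\sum_(j < k ^ 2) row_mult nu.+1 b r j)%N.
pose P r := take (m r) (planar_exps k (nu + d) r).
have [] := @planar_rank K charK k nu d (k ^ 2) b P k0.
- by move=> r _; rewrite map_take take_uniq // planar_exps_uniq.
- by move=> r _ p /mem_take /planar_exps_mem[].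
- by move=> r _; rewrite size_take_min geq_minl.
move=> L hL; exists L; apply: leq_trans hL; apply: leq_sum => r _.
rewrite size_take_min size_planar_exps minnC /m sum_row_mult //.
have := ltn_ord r; rewrite ltnS leq_eqVlt => /orP[/eqP->|->//].
by rewrite ltnn subnn muln0 addn0.
Qed.

Lemma card_power_rows m n nu :
  #|{: 'I_m * 'I_(size (monos n.+1 nu))}| = (m * 'C(nu + n, nu))%N.
Proof. by rewrite card_prod !card_ord size_monos. Qed.

Lemma bin_sub_right n m : 'C(n + m, n) = 'C(n + m, m).
Proof. by rewrite -[in RHS]bin_sub ?leq_addl // addnK. Qed.

(** If no row exceeds its number of conditions and the rows contain all monomials, the rank bound
    gives surjectivity; if no row falls short of it, the bound gives injectivity. The choice of [b]
    depends on how [nu + d] compares with [k * nu.+1]. *)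
Lemma planar_full k nu d : (2 <= k)%N ->
  exists L : 'M[K]_(k ^ 2, 3),
    (row_free (power_mx d nu L) || row_full (power_mx d nu L)) /\
    ((nu + d < k * nu.+1)%N -> row_full (power_mx d nu L)).
Proof.
move=> k2; have k0 : (0 < k)%N by lia.
pose s r := (\sum_(a < k) ((nu + d).+1 - (k * r + a)))%N.
pose m b r := (if (r < nu.+1)%N then k ^ 2 * (nu.+1 - r) - b else b * nu.+1)%N.
have full b : (b <= k ^ 2)%N -> (nu + d < k * nu.+2)%N ->
    (forall r, (r <= nu.+1)%N -> (s r <= m b r)%N) ->
    exists L : 'M[K]_(k ^ 2, 3), row_full (power_mx d nu L).
  move=> bN lt le; have [L hL] := planar_rank_min nu d k0 bN; exists L.
  rewrite /row_full eqn_leq rank_leq_col; apply: leq_trans hL.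
  rewrite size_monos bin_sub_right addn2 -(sum_rows lt); apply: leq_sum => r _.
  by rewrite leq_min leqnn; apply: le; rewrite -ltnS.
have free b : (b <= k ^ 2)%N -> (forall r, (r <= nu.+1)%N -> (m b r <= s r)%N) ->
    exists L : 'M[K]_(k ^ 2, 3), row_free (power_mx d nu L).
  move=> bN le; have [L hL] := planar_rank_min nu d k0 bN; exists L.
  rewrite /row_free eqn_leq rank_leq_row; apply: leq_trans hL.
  rewrite card_power_rows; apply: (@leq_trans (\sum_(r < nu.+2) m b r)).
    rewrite big_ord_recr /= {2}/m ltnn.
    rewrite (eq_bigr (fun r : 'I_nu.+1 => k ^ 2 * (nu.+1 - r) - b)%N) => [|r _]; last first.
      by rewrite /m ltn_ord.
    have : (\sum_(r < nu.+1) (k ^ 2 * (nu.+1 - r) - b) + b * nu.+1 =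
        k ^ 2 * \sum_(r < nu.+1) (nu.+1 - r))%N.
      rewrite big_distrr mulnC -[X in (_ + X * b)%N]card_ord -sum_nat_const -big_split /=.
      apply: eq_bigr => r _; rewrite subnK //; have := ltn_ord r.
      by move: (k ^ 2)%N bN => N bN rnu; nia.
    move=> ->; rewrite leq_mul2l bin_sub_right; apply/orP; right.
    have := @sum_subn nu.+1 nu.+1 (leqnSn _); have := bin2_double nu.+2; rewrite /= addn2; lia.
  by apply: leq_sum => r _; rewrite leq_min leqnn andbT; apply: le; rewrite -ltnS.
have sub_k2 r : (r <= nu.+1)%N -> (k ^ 2 * (nu.+1 - r) = k * (k * nu.+1 - k * r))%N.
  by move=> _; rewrite -mulnBr mulnA mulnn.
have [lt|ge] := ltnP (nu + d) (k * nu.+1).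
  have [|||L fL] := full 0%N => //; first by rewrite (leq_trans lt) // leq_mul2l leqnSn orbT.
    move=> r rnu; apply: (@leq_trans (k ^ 2 * (nu.+1 - r))); last first.
      by rewrite /m subn0; case: ltnP => // h; rewrite (_ : nu.+1 - r = 0)%N ?muln0 //; lia.
    rewrite sub_k2 // /s -[X in (_ <= X * _)%N]card_ord -sum_nat_const; apply: leq_sum => a _.
    by lia.
  by exists L; split=> //; rewrite fL orbT.
pose c := (nu + d - k * nu.+1)%N.
have sE r : (r <= nu)%N ->
    (2 * s r + k * k.-1 = 2 * (k * (k * (nu.+1 - r) + c.+1)))%N.
  move=> rnu; rewrite -sum_subn; last by move: (nu.+1 - r)%N (subn_gt0 r nu.+1) => q; nia.
  congr (2 * _ + _)%N; apply: eq_bigr => a _.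
  have : (k * r <= k * nu.+1)%N by rewrite leq_mul2l ltnW ?orbT.
  rewrite mulnBr /c; lia.
(* For every [r <= nu], twice the excess of [s r] over [k ^ 2 * (nu.+1 - r)] is
   [k * (2 * c + 3 - k)] as an integer, independent of [r]. *)
have [kc|kc] := leqP k (2 * c + 3).
  have [|r rnu|L fL] := free 0%N => //; last first.
    by exists L; rewrite fL; split=> //; rewrite ltnNge ge.
  rewrite /m subn0 mul0n; case: ltnP => // rn.
  have := sE r rn; move: (s r) (nu.+1 - r)%N => S q; nia.
(* With this b the rows below nu.+1 have exactly as many elements as conditions,
   so the last row alone decides between injectivity and surjectivity. *)
pose b := (k * (k - 3 - 2 * c))./2.
have bE : (2 * b = k * (k - 3 - 2 * c))%N.
  (* The two factors have opposite parity. *)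
  have : ~~ odd (k * (k - 3 - 2 * c)).
    by rewrite oddM oddB ?oddB ?oddM /=; [case: (odd k)|lia|lia].
  by move=> /even_halfK <-; rewrite -muln2 mulnC.
have bN : (b <= k ^ 2)%N by rewrite -mulnn; nia.
have smE r : (r <= nu)%N -> s r = m b r.
  move=> rnu; rewrite /m ltnS rnu; have := sE r rnu; rewrite -mulnn.
  have : (0 < nu.+1 - r)%N by lia.
  move: (s r) (nu.+1 - r)%N => S q; nia.
have [le|gt] := leqP (s nu.+1) (m b nu.+1).
  have [|||L fL] := full b => //.
  - by rewrite /c in kc; lia.
  - by move=> r; rewrite leq_eqVlt => /orP[/eqP->//|]; rewrite ltnS => /smE->.
  by exists L; rewrite fL orbT.
have [||L fL] := free b => //.
  by move=> r; rewrite leq_eqVlt => /orP[/eqP->|]; [exact: ltnW|rewrite ltnS => /smE->].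
by exists L; rewrite fL; split=> //; rewrite ltnNge ge.
Qed.

Definition spatial_exps i r : seq (nat * nat * nat) :=
  [seq (q, c) | q <- [seq (a, b) | a <- iota 0 2, b <- iota 0 2],
                c <- iota 0 (i.+1 - 2 * r - (q.1 + q.2))].

Lemma size_spatial_exps i r : size (spatial_exps i r) = cube_count (i.+1 - 2 * r).
Proof.
rewrite size_allpairs_dep /= !size_iota /cube_count; move: (i.+1 - 2 * r)%N => n.
by clear; lia.
Qed.

Lemma spatial_exps_mem i r p : p \in spatial_exps i r ->
  [/\ (p.1.1 < 2)%N, (p.1.2 < 2)%N & (p.1.1 + p.1.2 + p.2 + 2 * r <= i)%N].
Proof.
case/allpairsPdep => q [c [/allpairsPdep[a [b [+ + ->]]] + ->]] /=.
by rewrite !mem_iota /= => h1 h2 h3; split; lia.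
Qed.

Lemma spatial_exps_uniq i r :
  uniq [seq (p.1.1 + 2 * p.1.2 + 4 * p.2)%N | p <- spatial_exps i r].
Proof.
rewrite map_inj_in_uniq.
  by apply: allpairs_uniq_dep => [|q _|[q c] [q' c'] _ _ /= [-> ->]] //; exact: iota_uniq.
move=> [[a b] c] [[a' b'] c'] /spatial_exps_mem [/= a2 b2 _] /spatial_exps_mem [/= a2' b2' _] e.
have -> : a = a' by lia.
have -> : b = b' by lia.
by have -> : c = c' by lia.
Qed.

(** Since [cube_count n] is [4 * n - 4] for [n >= 2], whether a row is at most or at least
    [8 * (nu.+1 - r)] depends only on whether [nu + d < 2 * nu.+1], so all rows agree. *)
Lemma spatial_full nu d :
  exists L : 'M[K]_(8, 4),
    (row_free (power_mx d nu L) || row_full (power_mx d nu L)) /\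
    ((nu + d < 2 * nu.+1)%N -> row_full (power_mx d nu L)).
Proof.
pose P r := take (8 * (nu.+1 - r)) (spatial_exps (nu + d) r).
have [] := @spatial_rank K charK nu d 8 P.
- by move=> r _; rewrite map_take take_uniq // spatial_exps_uniq.
- by move=> r _ p /mem_take /spatial_exps_mem[].
- by move=> r _; rewrite size_take_min geq_minl.
move=> L hL; exists L; have [lt|ge] := ltnP (nu + d) (2 * nu.+1).
  suff full : row_full (power_mx d nu L) by rewrite full orbT.
  rewrite /row_full eqn_leq rank_leq_col; apply: leq_trans hL.
  rewrite size_monos bin_sub_right addn3 -(sum_cube_count lt); apply: leq_sum => r _.
  rewrite leq_mul2l size_take_min size_spatial_exps leq_min leqnn andbT.
  have := ltn_ord r; rewrite /cube_count; lia.
suff free : row_free (power_mx d nu L) by rewrite free.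
rewrite /row_free eqn_leq rank_leq_row; apply: leq_trans hL.
rewrite card_power_rows bin_sub_right addn3 -sum_antidiag big_distrr /=; apply: leq_sum => r _.
rewrite mulnCA leq_mul2l size_take_min size_spatial_exps leq_min leqnn.
have := ltn_ord r; rewrite /cube_count; lia.
Qed.

End Points.

(** * Descending chains of subspaces *)

Section Subspaces.
Variables (K : fieldType) (q : nat).

Definition is_subspace (V : 'rV[K]_q -> Prop) :=
  [/\ V 0, forall u v, V u -> V v -> V (u + v) & forall c v, V v -> V (c *: v)].

(** A matrix of maximal rank with row space inside [V] spans [V], since any further vector would
    raise the rank. *)
Lemma subspace_mx V : is_subspace V -> exists A : 'M[K]_q, forall v, V v <-> (v <= A)%MS.
Proof.
case=> V0 VD VZ.
pose P r := boolp.asbool (exists2 A : 'M[K]_q, \rank A = r & forall v, (v <= A)%MS -> V v).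
have exP : exists r, P r.
  by exists 0%N; apply/boolp.asboolP; exists 0; rewrite ?mxrank0 // => v /submx0null->.
have maxP r : P r -> (r <= q)%N.
  by move=> /boolp.asboolP[A <- _]; apply: rank_leq_row.
case: (ex_maxnP exP maxP) => r /boolp.asboolP[A rA VA] rmax.
exists A => v; split=> [Vv|]; last exact: VA.
apply: contraT => vA.
have /rmax : P (\rank (A + v)%MS).
  apply/boolp.asboolP; exists (A + v)%MS => // w /sub_addsmxP[[u1 u2] ->] /=.
  apply: VD; first by apply: VA; apply: submxMl.
  by rewrite [u2]mx11_scalar mul_scalar_mx; apply: VZ.
rewrite -rA leqNgt; case/negP; rewrite ltn_neqAle mxrankS ?addsmxSl // andbT.
apply: contra vA => /eqP e.
apply: submx_trans (addsmxSr A v) _.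
by rewrite -(geq_leqif (mxrank_leqif_sup (addsmxSl A v))) -e.
Qed.

(** The chain is constant from a member of minimal dimension on. *)
Lemma subspace_dcc (V : nat -> 'rV[K]_q -> Prop) :
  (forall i, is_subspace (V i)) -> (forall i v, V i.+1 v -> V i v) ->
  exists N, forall i, (N <= i)%N -> forall v, V i v <-> V N v.
Proof.
move=> subV decV.
pose P r := boolp.asbool (exists i, exists2 A : 'M[K]_q, \rank A = r &
  forall v, V i v <-> (v <= A)%MS).
have exP : exists r, P r.
  have [A VA] := subspace_mx (subV 0%N).
  by exists (\rank A); apply/boolp.asboolP; exists 0%N; exists A.
case: (ex_minnP exP) => r /boolp.asboolP[N [A rA VA]] rmin.
have mono i j v : (i <= j)%N -> V j v -> V i v.
  by move=> /subnKC<-; elim: (j - i)%N v => [|k IH] v; rewrite ?addn0 ?addnS // => /decV/IH.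
exists N => i Ni v; split; first exact: mono.
have [B VB] := subspace_mx (subV i).
have BA : (B <= A)%MS.
  by apply/row_subP => k; apply/VA/(mono _ _ _ Ni)/VB/row_sub.
have /rmin rB : P (\rank B) by apply/boolp.asboolP; exists i; exists B.
have AB : (A <= B)%MS by rewrite -(geq_leqif (mxrank_leqif_sup BA)) rA.
by move=> /VA h; apply/VB; apply: submx_trans AB.
Qed.

End Subspaces.

Lemma mnm_split n M (m : 'X_{1..n}) : (M <= mdeg m)%N ->
  exists m1 m2, mdeg m1 = M /\ m = (m1 + m2)%MM.
Proof.
move=> Mm; exists (s2m (take M (m2s m))), (s2m (drop M (m2s m))).
rewrite mdeg_s2m size_take_min size_m2s (minn_idPl Mm); split=> //.
rewrite -[LHS]s2mK -{1}(cat_take_drop M (m2s m)); apply/mnmP => i.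
by rewrite !mnmE count_cat.
Qed.

(** * A criterion for artinian quotients *)

Section Artinian.
Variables (K : fieldType) (n : nat) (I : idealr {mpoly K[n]}).

Local Notation pi := (\pi_{ideal_quot I}).

Lemma pi_eqP p r : pi p = pi r <-> p - r \in I.
Proof. by rewrite Quotient.idealrBE; split=> /eqP. Qed.

(** The monomials of degree less than [M] span the quotient, so a descending chain of ideals pulls
    back to a descending chain of subspaces of a finite-dimensional space. *)
Lemma artinian_homog_sub M : (forall p, p \is M.-homog -> p \in I) -> artinian {ideal_quot I}.
Proof.
move=> homI J idJ decJ.
pose mon (k : 'I_#|{: 'X_{1..n < M}}|) : {mpoly K[n]} := 'X_[enum_val k].
pose ev (v : 'rV[K]_#|{: 'X_{1..n < M}}|) : {mpoly K[n]} := \sum_k v 0 k *: mon k.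
have evD u v : ev (u + v) = ev u + ev v.
  by rewrite /ev -big_split; apply: eq_bigr => k _; rewrite mxE scalerDl.
have evZ c v : ev (c *: v) = c *: ev v.
  by rewrite /ev scaler_sumr; apply: eq_bigr => k _; rewrite mxE scalerA.
have ev0 : ev 0 = 0 by rewrite -(scale0r 0) evZ scale0r.
have surj p : exists v, pi p = pi (ev v).
  rewrite [p]mpolyE; elim: (msupp p) => [|m s [v IH]].
    by exists 0; rewrite big_nil ev0.
  suff [u hu] : exists u, pi (p@_m *: 'X_[m]) = pi (ev u).
    by exists (u + v); rewrite big_cons evD !rmorphD /= hu IH.
  have [mM|Mm] := ltnP (mdeg m) M.
    exists (p@_m *: delta_mx 0 (enum_rank (BMultinom mM))); rewrite evZ; congr (pi (_ *: _)).
    rewrite /ev (bigD1 (enum_rank (BMultinom mM))) //= mxE !eqxx scale1r big1 ?addr0.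
      by rewrite /mon enum_rankK.
    by move=> k /negbTE km; rewrite mxE km andbF scale0r.
  exists 0; rewrite ev0; apply/pi_eqP; rewrite subr0.
  have [m1 [m2 [e ->]]] := mnm_split Mm.
  rewrite addmC mpolyXD -mul_mpolyC mulrA; apply/idealMr/homI.
  by rewrite dhomogX /= e.
pose V i v := J i (pi (ev v)).
have [||N hN] := @subspace_dcc K _ V.
- move=> i; have [J0 JD JM] := idJ i; split.
  + by rewrite /V ev0 raddf0.
  + by move=> u v hu hv; rewrite /V evD rmorphD; apply: JD.
  + by move=> c v hv; rewrite /V evZ -mul_mpolyC rmorphM; apply: JM.
- by move=> i v; apply: decJ.
exists N => i Ni x; have [v hv] := surj (repr x).
by move: (hN i Ni v); rewrite /V -hv reprK.
Qed.

End Artinian.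

(** * Homogeneous elements of the ideal of powers *)

Section Powers.
Variables (K : fieldType) (n m d : nat).
Implicit Types (L : 'M[K]_(m, n)).

Definition in_powers L p := exists c, p = power_sum d L c.

Lemma power_idealrP (d_gt0 : (0 < d)%N) L p :
  reflect (in_powers L p) (p \in power_idealr d_gt0 L).
Proof. exact: boolp.asboolP. Qed.

Lemma in_powersD L p q : in_powers L p -> in_powers L q -> in_powers L (p + q).
Proof.
move=> [c ->] [c' ->]; exists (fun j => c j + c' j); rewrite /power_sum -big_split.
by apply: eq_bigr => j _; rewrite mulrDl.
Qed.

Lemma in_powersM L p q : in_powers L q -> in_powers L (p * q).
Proof.
move=> [c ->]; exists (fun j => p * c j); rewrite /power_sum mulr_sumr.
by apply: eq_bigr => j _; rewrite mulrA.
Qed.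

Lemma in_powers0 L : in_powers L 0.
Proof. by exists (fun=> 0); rewrite /power_sum big1 // => j _; rewrite mul0r. Qed.

Lemma in_powers_power L j w : in_powers L (w * linear_form (row j L) ^+ d).
Proof.
exists (fun k => if k == j then w else 0); rewrite /power_sum (bigD1 j) //= eqxx.
by rewrite big1 ?addr0 // => k /negbTE->; rewrite mul0r.
Qed.

Lemma in_powers_homog_leq L i i' :
  (forall p, p \is i.-homog -> in_powers L p) -> (i <= i')%N ->
  forall p, p \is i'.-homog -> in_powers L p.
Proof.
move=> h ii' p hp; rewrite (homog_monosE hp).
suff H x : x \in monos n i' -> in_powers L (p@_x *: 'X_[x]).
  rewrite big_seq; elim/big_ind: _ => //; [exact: in_powers0|exact: in_powersD].
rewrite mem_monos => /eqP xi; have [|m1 [m2 [e ->]]] := @mnm_split _ i x; first by rewrite xi.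
rewrite addmC mpolyXD -mul_mpolyC mulrA; apply/in_powersM/h.
by rewrite dhomogX /= e.
Qed.

Definition injective_at nu L := forall c, (forall j, c j \is nu.-homog) ->
  power_sum d L c = 0 -> forall j, c j = 0.

(** The coefficients may be inhomogeneous here; [in_powers_homog] makes them homogeneous. *)
Definition surjective_at nu L :=
  forall p, p \is (nu + d).-homog -> in_powers L p.

Lemma pihomogM e i (p q : {mpoly K[n]}) : q \is e.-homog ->
  pihomog mdeg (i + e) (p * q) = pihomog mdeg i p * q.
Proof.
move=> hq; rewrite [p]mpolyE mulr_suml !raddf_sum mulr_suml; apply: eq_bigr => x _.
rewrite -scalerAl /= !linearZ /= -scalerAl pihomogX; congr (_ *: _).
have hx : 'X_[x] * q \is (mdeg x + e).-homog by apply: dhomogM; rewrite ?dhomogX.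
case: eqP => [<-|/eqP xi]; first exact: pihomog_dE.
by rewrite mul0r; apply: pihomog_ne0 hx; rewrite eqn_add2r.
Qed.

Lemma pihomogM_lt e i (p q : {mpoly K[n]}) : q \is e.-homog -> (i < e)%N ->
  pihomog mdeg i (p * q) = 0.
Proof.
move=> hq ie; rewrite [p]mpolyE mulr_suml raddf_sum big1 // => x _.
rewrite -scalerAl /= linearZ /=.
have hx : 'X_[x] * q \is (mdeg x + e).-homog by apply: dhomogM; rewrite ?dhomogX.
by rewrite (pihomog_ne0 _ hx) ?scaler0 // gtn_eqF // ltn_addl.
Qed.

(* Truncate the coefficients to the degree that contributes. *)
Lemma in_powers_homog nu L p : p \is (nu + d).-homog -> in_powers L p ->
  exists2 c, (forall j, c j \is nu.-homog) & p = power_sum d L c.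
Proof.
move=> hp [c pc]; exists (fun j => pihomog mdeg nu (c j)) => [j|].
  exact: pihomogP.
rewrite -(pihomog_dE hp) pc raddf_sum; apply: eq_bigr => j _ /=.
by rewrite pihomogM // linear_form_exp_homog.
Qed.

End Powers.

(** * Substitution homomorphisms *)

Section Hom.
Variables (K : fieldType).

Lemma mpoly_hom_ext n (S : comNzRingType) (f g : {rmorphism {mpoly K[n]} -> S}) :
  (forall c, f c%:MP = g c%:MP) -> (forall i, f 'X_i = g 'X_i) -> f =1 g.
Proof.
move=> fgC fgX p; rewrite [p]mpolyE !rmorph_sum; apply: eq_bigr => x _.
rewrite -mul_mpolyC !rmorphM fgC; congr (_ * _).
rewrite mpolyXE_id !rmorph_prod; apply: eq_bigr => i _.
by rewrite !rmorphXn fgX.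
Qed.

Definition subst n m (h : 'I_n -> {mpoly K[m]}) : {mpoly K[n]} -> {mpoly K[m]} :=
  mmap (@mpolyC m K) h.
HB.instance Definition _ n m h := GRing.RMorphism.on (@subst n m h).

Lemma substC n m h c : @subst n m h c%:MP = c%:MP.
Proof. exact: mmapC. Qed.

Lemma substX n m h i : @subst n m h 'X_i = h i.
Proof. by rewrite /subst mmapX mmap1U. Qed.

Lemma substZ n m h c p : @subst n m h (c *: p) = c *: subst h p.
Proof. by rewrite -!mul_mpolyC rmorphM /= substC. Qed.

Lemma subst_linear_form n m h a :
  @subst n m h (linear_form a) = \sum_i a 0 i *: h i.
Proof. by rewrite rmorph_sum; apply: eq_bigr => i _; rewrite /= substZ substX. Qed.

Lemma subst_homog n m (h : 'I_n -> {mpoly K[m]}) i p :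
  (forall k, h k \is 1.-homog) -> p \is i.-homog -> subst h p \is i.-homog.
Proof.
move=> hh hp; rewrite (homog_monosE hp) rmorph_sum big_seq; apply: rpred_sum => x.
rewrite mem_monos => /eqP xi; rewrite /= substZ; apply: dhomogZ.
rewrite mpolyXE_id rmorph_prod /= -xi mdegE.
elim/big_rec2: _ => [|k e q _ hq]; first exact: dhomog1.
rewrite rmorphXn /= substX; apply: dhomogM hq.
by have := dhomogMn (x k) (hh k); rewrite mul1n.
Qed.

End Hom.

(** * Elimination of one variable modulo a linear form *)

Section Restriction.
Variables (K : fieldType) (n : nat).
Implicit Types (a : 'rV[K]_n.+1).

Local Notation lift_max := (lift (@ord_max n)).

(* Up to a nonzero scalar, reduction modulo linear_form a, as a map to the
   polynomials in the first n variables. *)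
Definition proj_form a : {mpoly K[n.+1]} -> {mpoly K[n]} :=
  subst (fun i => if unlift ord_max i is Some k then a 0 ord_max *: 'X_k
                  else - \sum_k a 0 (lift_max k) *: 'X_k).
HB.instance Definition _ a := GRing.RMorphism.on (proj_form a).

(** These are the forms l'_j, without denominators, so that the entries are polynomial in [L] and in
    [a]. *)
Definition restr m (L : 'M[K]_(m, n.+1)) a : 'M[K]_(m, n) :=
  \matrix_(j, k) (a 0 ord_max * L j (lift_max k) - L j ord_max * a 0 (lift_max k)).

Definition incl : {mpoly K[n]} -> {mpoly K[n.+1]} := subst (fun k => 'X_(lift_max k)).
HB.instance Definition _ := GRing.RMorphism.on incl.

Lemma big_lift_max (R : nmodType) (F : 'I_n.+1 -> R) :
  \sum_i F i = \sum_k F (lift_max k) + F ord_max.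
Proof.
rewrite big_ord_recr; congr (_ + _); apply: eq_bigr => k _; congr F.
by apply: val_inj; rewrite /= /bump leqNgt ltn_ord.
Qed.

Lemma proj_linear_form m (L : 'M[K]_(m, n.+1)) a j :
  proj_form a (linear_form (row j L)) = linear_form (row j (restr L a)).
Proof.
rewrite /proj_form subst_linear_form big_lift_max unlift_none scalerN scaler_sumr.
rewrite -sumrB; apply: eq_bigr => k _; rewrite liftK !mxE !scalerA -scalerBl.
by congr (_ *: _); rewrite mulrC.
Qed.

Lemma proj_form_self a : proj_form a (linear_form a) = 0.
Proof.
rewrite /proj_form subst_linear_form big_lift_max unlift_none scalerN scaler_sumr.
rewrite -sumrB big1 // => k _; rewrite liftK !scalerA -scalerBl.
by rewrite mulrC subrr scale0r.
Qed.

Lemma subst_scale i c (p : {mpoly K[n.+1]}) : p \is i.-homog ->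
  subst (fun k => c *: 'X_k) p = c ^+ i *: p.
Proof.
move=> hp; rewrite (homog_monosE hp) rmorph_sum scaler_sumr.
apply: eq_big_seq => x; rewrite mem_monos => /eqP xi.
rewrite /= substZ !scalerA [c ^+ i * _]mulrC -scalerA; congr (_ *: _).
rewrite mpolyXE_id rmorph_prod /= -xi mdegE.
elim/big_rec3: _ => [|k e q r _ ->]; first by rewrite scale1r.
by rewrite rmorphXn /= substX exprZn -scalerAl -scalerAr scalerA exprD.
Qed.

(** The congruence modulo [linear_form a] is stable under sums and products, so constants and
    variables suffice. *)
Lemma incl_proj a p : exists q,
  incl (proj_form a p) - subst (fun k => a 0 ord_max *: 'X_k) p = linear_form a * q.
Proof.
pose f : {rmorphism {mpoly K[n.+1]} -> {mpoly K[n.+1]}} := incl \o proj_form a.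
pose g : {rmorphism {mpoly K[n.+1]} -> {mpoly K[n.+1]}} :=
  subst (fun k => a 0 ord_max *: 'X_k).
rewrite -/(f p) -/(g p).
have congD x y : (exists q, f x - g x = linear_form a * q) ->
    (exists q, f y - g y = linear_form a * q) ->
    exists q, f (x + y) - g (x + y) = linear_form a * q.
  move=> [q hq] [r hr]; exists (q + r).
  by rewrite mulrDr -hq -hr !rmorphD opprD addrACA.
have congM x y : (exists q, f x - g x = linear_form a * q) ->
    (exists q, f y - g y = linear_form a * q) ->
    exists q, f (x * y) - g (x * y) = linear_form a * q.
  move=> [q hq] [r hr]; exists (q * f y + g x * r).
  rewrite mulrDr mulrA -hq [linear_form a * (_ * _)]mulrCA -hr !rmorphM.
  by rewrite mulrBl mulrBr addrA subrK.
have congC c : exists q, f c%:MP - g c%:MP = linear_form a * q.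
  by exists 0; rewrite /f /g /= /proj_form /incl !substC subrr mulr0.
have congX i : exists q, f 'X_i - g 'X_i = linear_form a * q.
  rewrite /f /g /= /proj_form /incl !substX; case: (unliftP ord_max i) => [k|] ->.
    by exists 0; rewrite substZ substX subrr mulr0.
  exists (-1); rewrite rmorphN rmorph_sum mulrN1 /linear_form big_lift_max opprD.
  by congr (- _ - _); apply: eq_bigr => k _; rewrite /= substZ substX.
rewrite [p]mpolyE; elim: (msupp p) => [|x s IH].
  by exists 0; rewrite big_nil !rmorph0 subrr mulr0.
rewrite big_cons; apply: congD IH; rewrite -mul_mpolyC; apply: (congM _ _) => //.
rewrite mpolyXE_id; elim/big_rec: _ => [|k q _ IH]; first by rewrite -mpolyC1.
apply: (congM _ _ _ IH); elim: (x k) => [|e IHe]; first by rewrite expr0 -mpolyC1.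
by rewrite exprS; apply: congM.
Qed.

Lemma proj_form_ker a i p : a 0 ord_max != 0 -> p \is i.-homog ->
  proj_form a p = 0 -> exists q, p = linear_form a * q.
Proof.
move=> a0 hp p0; have [q] := incl_proj a p.
rewrite p0 rmorph0 sub0r (subst_scale _ hp) => e.
exists (- (a 0 ord_max ^- i) *: q); rewrite -scalerAr -e scalerN scaleNr opprK scalerA.
by rewrite mulVf ?scale1r // expf_neq0.
Qed.

Lemma proj_form_homog a i p : p \is i.-homog -> proj_form a p \is i.-homog.
Proof.
apply: subst_homog => k; have X1 l : ('X_l : {mpoly K[n]}) \is 1.-homog.
  by rewrite dhomogX /= mdeg1.
case: unlift => [l|]; first exact: dhomogZ.
by rewrite rpredN; apply: rpred_sum => l _; apply: dhomogZ.
Qed.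

Lemma incl_homog i p : p \is i.-homog -> incl p \is i.-homog.
Proof. by apply: subst_homog => k; rewrite dhomogX /= mdeg1. Qed.

Lemma proj_incl a i p : p \is i.-homog -> proj_form a (incl p) = a 0 ord_max ^+ i *: p.
Proof.
move=> hp; rewrite (homog_monosE hp) [incl _]rmorph_sum [proj_form a _]rmorph_sum scaler_sumr.
apply: eq_big_seq => x; rewrite mem_monos => /eqP xi.
rewrite /= /proj_form /incl !substZ !scalerA [a _ _ ^+ i * _]mulrC -scalerA; congr (_ *: _).
rewrite mpolyXE_id !rmorph_prod /= -xi mdegE.
elim/big_rec3: _ => [|k e q r _ ->]; first by rewrite scale1r.
by rewrite !rmorphXn /= !substX liftK exprZn -scalerAl -scalerAr scalerA exprD.
Qed.

End Restriction.

Lemma polyfun_comp (K : fieldType) m n p q (f : 'M[K]_(m, n) -> K)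
    (v : 'M[K]_(p, q) -> 'M[K]_(m, n)) :
  polyfun f -> (forall i j, polyfun (fun M => v M i j)) -> polyfun (fun M => f (v M)).
Proof.
move=> [g hg] pv; apply: (@polyfun_ext _ _ _ (fun M => g.@[fun j => mxvec (v M) 0 j])).
  by move=> M; rewrite hg.
apply: polyfun_meval => i; case/mxvec_indexP: i => i j.
by apply: polyfun_ext (pv i j) => M; rewrite mxvecE.
Qed.

(** * From Psi_nu to multiplication by a linear form *)

Section MaxRank.
Variables (K : fieldType) (n m d : nat) (d_gt0 : (0 < d)%N).
Variables (L : 'M[K]_(m, n.+1)) (a : 'rV[K]_n.+1).
Hypothesis a_max : a 0 ord_max != 0.

Local Notation I := (power_idealr d_gt0 L).
Local Notation pi := (\pi_{ideal_quot I}).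

Lemma linear_form_neq0 : linear_form a != 0.
Proof.
apply: contraNneq a_max => /(congr1 (mcoeff U_(ord_max))).
rewrite mcoeff0 raddf_sum (bigD1 ord_max) //= mcoeffZ mcoeffXU eqxx mulr1 big1 ?addr0.
  by move=> ->.
by move=> k /negbTE km; rewrite mcoeffZ mcoeffXU km mulr0.
Qed.

Lemma proj_power_sum c : proj_form a (power_sum d L c) =
  power_sum d (restr L a) (fun j => proj_form a (c j)).
Proof.
rewrite /power_sum rmorph_sum; apply: eq_bigr => j _.
by rewrite rmorphM rmorphXn /= proj_linear_form.
Qed.

Lemma max_rank_restr i :
  (forall nu, injective_at d nu (restr L a) \/ surjective_at d nu (restr L a)) ->
  mul_max_rank (pi (linear_form a)) i.
Proof.
move=> good.
have inj_case : (forall r, r \is i.-homog -> in_powers d L (linear_form a * r) ->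
    in_powers d L r) ->
    forall x y, graded_piece i x -> graded_piece i y ->
      pi (linear_form a) * x = pi (linear_form a) * y -> x = y.
  move=> h x y [p hp ->] [q hq ->]; rewrite -!rmorphM => /pi_eqP/power_idealrP.
  rewrite -mulrBr => /(h _ _) r; apply/pi_eqP/power_idealrP/r.
  exact: rpredB.
have homogM r : r \is i.-homog -> linear_form a * r \is i.+1.-homog.
  by move=> hr; have := dhomogM (linear_form_homog a) hr; rewrite add1n.
(* Below degree [d] the ideal has no nonzero homogeneous elements, and multiplication by a nonzero
   form is injective. *)
have [id|di] := ltnP i.+1 d.
  left; apply: inj_case => r hr [c rc].
  suff -> : r = 0 by exact: in_powers0.
  have /eqP : linear_form a * r = 0.
    rewrite -(pihomog_dE (homogM r hr)) rc raddf_sum big1 // => j _ /=.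
    by apply: pihomogM_lt (linear_form_exp_homog _ _) id.
  by rewrite mulf_eq0 (negbTE linear_form_neq0) => /eqP.
pose nu := (i.+1 - d)%N; have inu : i.+1 = (nu + d)%N by rewrite subnK.
have [inj|surj] := good nu.
  left; apply: inj_case => r hr h.
  have hlr : linear_form a * r \is (nu + d).-homog by rewrite -inu homogM.
  have [c hc e] := in_powers_homog hlr h.
  have c0 : forall j, proj_form a (c j) = 0.
    apply: inj => [j|]; first exact: proj_form_homog.
    by rewrite -proj_power_sum -e rmorphM /= proj_form_self mul0r.
  have /boolp.choice[q qE] : forall j, exists q, c j = linear_form a * q.
    by move=> j; apply: proj_form_ker (hc j) (c0 j).
  exists q; apply: (mulfI linear_form_neq0); rewrite e /power_sum mulr_sumr.
  by apply: eq_bigr => j _; rewrite qE mulrA.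
right=> x [q hq ->].
have hq' : q \is (nu + d).-homog by rewrite -inu.
have [c hc pq] := in_powers_homog (proj_form_homog a hq') (surj _ (proj_form_homog a hq')).
(* The scalar cancels the factor that [proj_incl] produces. *)
pose c' j := a 0 ord_max ^- nu *: incl (c j).
have hc' j : c' j \is nu.-homog by apply/dhomogZ/incl_homog.
have pr0 : proj_form a (q - power_sum d L c') = 0.
  rewrite rmorphB /= proj_power_sum pq; apply/eqP; rewrite subr_eq0; apply/eqP.
  apply: eq_power_sum => j; rewrite /c' /proj_form substZ -/(proj_form a _).
  by rewrite (proj_incl a (hc j)) scalerA mulVf ?scale1r // expf_neq0.
have hr : q - power_sum d L c' \is (nu + d).-homog.
  by apply: rpredB => //; apply: power_sum_homog.
have [e qe] := proj_form_ker a_max hr pr0.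
(* The cofactor [e] may be inhomogeneous; its part of degree [i] gives the same product. *)
exists (pi (pihomog mdeg i e)); first by exists (pihomog mdeg i e) => //; apply: pihomogP.
rewrite -rmorphM; apply/pi_eqP/power_idealrP.
have -> : linear_form a * pihomog mdeg i e = q - power_sum d L c'.
  rewrite -(pihomog_dE hr) qe -inu mulrC [_ * e]mulrC -[in RHS](addn1 i).
  by rewrite pihomogM // linear_form_homog.
rewrite addrAC subrr add0r; exists (fun j => - c' j); rewrite /power_sum -sumrN.
by apply: eq_bigr => j _; rewrite mulNr.
Qed.

End MaxRank.

(** * The artinian property, openness and the conclusion *)

Section Main.
Variables (K : fieldType) (charK : [pchar K] =i pred0).
Variables (n m d : nat) (d_gt0 : (0 < d)%N).

(* Every form of degree m * d in the m linear forms involves a d-th power. *)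
Lemma artinian_powers (L : 'M[K]_(m, n)) : (0 < m)%N -> row_full L ->
  artinian {ideal_quot (power_idealr d_gt0 L)}.
Proof.
move=> m0 /row_fullP[B BL]; apply: (@artinian_homog_sub _ _ _ (m * d)) => p hp.
apply/power_idealrP.
pose th : {rmorphism {mpoly K[m]} -> {mpoly K[n]}} := subst (fun j => linear_form (row j L)).
pose be : {rmorphism {mpoly K[n]} -> {mpoly K[m]}} :=
  subst (fun k => linear_form (row k B)).
(* Since [B *m L] is the identity, rewriting the variables in terms of the linear forms and
   substituting back changes nothing. *)
have -> : p = th (be p).
  pose idm : {rmorphism {mpoly K[n]} -> {mpoly K[n]}} := idfun.
  pose tb : {rmorphism {mpoly K[n]} -> {mpoly K[n]}} := th \o be.
  rewrite -[LHS]/(idm p) -[RHS]/(tb p); apply: mpoly_hom_ext => [c|k] /=.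
    by rewrite !substC.
  rewrite substX subst_linear_form /linear_form.
  transitivity (\sum_i (B *m L) k i *: ('X_i : {mpoly K[n]})).
    rewrite BL (bigD1 k) //= mxE eqxx scale1r big1 ?addr0 // => i /negbTE ik.
    by rewrite mxE eq_sym ik scale0r.
  under [RHS]eq_bigr do rewrite scaler_sumr.
  rewrite exchange_big /=; apply: eq_bigr => i _.
  by rewrite mxE scaler_suml; apply: eq_bigr => j _; rewrite !mxE scalerA.
have hbe : be p \is (m * d).-homog.
  by apply: subst_homog => // k; apply: linear_form_homog.
rewrite (homog_monosE hbe) rmorph_sum big_seq.
elim/big_ind: _ => [||x]; [exact: in_powers0|exact: in_powersD|].
rewrite mem_monos => /eqP xd; rewrite -mul_mpolyC rmorphM; apply: in_powersM.
(* If all exponents were at most [d - 1], the degree would be at most [m * (d - 1)]. *)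
have [j jd] : exists j, (d <= x j)%N.
  apply: boolp.contrapT => nx.
  have : (mdeg x <= \sum_(j < m) d.-1)%N.
    rewrite mdegE; apply: leq_sum => j _; rewrite -ltnS prednK // ltnNge.
    by apply/negP => dx; apply: nx; exists j.
  by rewrite xd sum_nat_const card_ord leq_mul2l gtn_eqF // leqNgt prednK // leqnn.
rewrite mpolyXE_id rmorph_prod (bigD1 j) //= rmorphXn /= substX mulrC.
by rewrite -(subnK jd) exprD mulrA; apply: in_powers_power.
Qed.

Lemma restr_polyfunl (a : 'rV[K]_n.+1) i j :
  polyfun (fun L : 'M[K]_(m, n.+1) => restr L a i j).
Proof.
apply: (@polyfun_ext _ _ _ (fun L => a 0 ord_max * L i (lift ord_max j) +
    (- a 0 (lift ord_max j)) * L i ord_max)).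
  by move=> L; rewrite mxE mulNr mulrC; congr (_ - _); rewrite mulrC.
by apply: polyfunD; apply: polyfunM; (exact: polyfun_const || exact: polyfun_entry).
Qed.

Lemma restr_polyfunr (L : 'M[K]_(m, n.+1)) i j :
  polyfun (fun a : 'rV[K]_n.+1 => restr L a i j).
Proof.
apply: (@polyfun_ext _ _ _ (fun a : 'rV[K]_n.+1 => L i (lift ord_max j) * a 0 ord_max +
    (- L i ord_max) * a 0 (lift ord_max j))).
  by move=> a; rewrite mxE mulNr [_ * a _ _]mulrC.
by apply: polyfunD; apply: polyfunM; (exact: polyfun_const || exact: polyfun_entry).
Qed.

(** The map [v] is arbitrary so that the lemma covers [restr] as a function of [L] and as a function
    of [a]. *)
Lemma dense_open_full p q nu (v : 'M[K]_(p, q) -> 'M[K]_(m, n)) :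
  (forall i j, polyfun (fun M => v M i j)) ->
  (exists M, row_full (power_mx d nu (v M))) ->
  dense_open (fun M => row_full (power_mx d nu (v M))).
Proof.
move=> pv [M0 h].
have := @dense_open_rank K _ _ _ _ (fun M => power_mx d nu (v M)) (size (monos n (nu + d))).
case=> [i j||f pf [ex fP]]; first exact: (polyfun_comp (power_mx_polyfun _ i j) pv).
  by exists M0; rewrite (eqP h).
by exists f => //; split=> // M /fP; rewrite /row_full eqn_leq rank_leq_col.
Qed.

Lemma dense_open_free_full p q nu (v : 'M[K]_(p, q) -> 'M[K]_(m, n)) :
  (forall i j, polyfun (fun M => v M i j)) ->
  (exists M, row_free (power_mx d nu (v M)) || row_full (power_mx d nu (v M))) ->
  dense_open (fun M => row_free (power_mx d nu (v M)) || row_full (power_mx d nu (v M))).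
Proof.
move=> pv [M0 /orP[h|h]]; last first.
  have := dense_open_full pv (ex_intro _ M0 h).
  by apply: dense_open_sub => M ->; rewrite orbT.
have := @dense_open_rank K _ _ _ _ (fun M => power_mx d nu (v M))
  #|{: 'I_m * 'I_(size (monos n nu))}|.
case=> [i j||f pf [ex fP]]; first exact: (polyfun_comp (power_mx_polyfun _ i j) pv).
  by exists M0; rewrite (eqP h).
by exists f => //; split=> // M /fP; rewrite /row_free eqn_leq rank_leq_row => ->.
Qed.

End Main.

(** Genericity comes in two stages. For the fixed form [a0], the conditions on [restr L a0] are open
    in [L]; for each such [L], the conditions on [restr L a] are open in [a] and hold at [a0]. *)
Lemma generically_weak_lefschetz (K : fieldType) (charK : [pchar K] =i pred0)
    n m d (d_gt0 : (0 < d)%N) nu1 : (n < m)%N ->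
  (forall nu, exists L : 'M[K]_(m, n),
     row_free (power_mx d nu L) || row_full (power_mx d nu L)) ->
  (exists L : 'M[K]_(m, n), row_full (power_mx d nu1 L)) ->
  generically (fun L : 'M[K]_(m, n.+1) => weak_lefschetz (power_idealr d_gt0 L)).
Proof.
move=> nm good full.
(* For the last variable [restr] drops the last column, so [ext] gives a preimage of any [L']. *)
pose a0 : 'rV[K]_n.+1 := delta_mx 0 ord_max.
pose ext (L' : 'M[K]_(m, n)) : 'M[K]_(m, n.+1) :=
  \matrix_(j, i) if unlift ord_max i is Some k then L' j k else 0.
have extK L' : restr (ext L') a0 = L'.
  by apply/matrixP => i j; rewrite !mxE liftK unlift_none !eqxx mul1r mul0r subr0.
apply: dense_open_generically.
have D1 : dense_open (fun L : 'M[K]_(m, n.+1) => (n.+1 <= \rank L)%N).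
  apply: dense_open_rank => [i j|]; first exact: polyfun_entry.
  by exists (pid_mx n.+1); rewrite rank_pid_mx.
have D2 : dense_open (fun L : 'M[K]_(m, n.+1) => forall nu, (nu < nu1)%N ->
    row_free (power_mx d nu (restr L a0)) || row_full (power_mx d nu (restr L a0))).
  apply: dense_open_all => // nu _; apply: dense_open_free_full => [i j|].
    exact: restr_polyfunl.
  by have [L' h] := good nu; exists (ext L'); rewrite extK.
have D3 : dense_open (fun L : 'M[K]_(m, n.+1) => row_full (power_mx d nu1 (restr L a0))).
  apply: dense_open_full => [i j|]; first exact: restr_polyfunl.
  by have [L' h] := full; exists (ext L'); rewrite extK.
apply: dense_open_sub (dense_openI charK D1 (dense_openI charK D2 D3)) => L [rL [gL fL]].
split.
  by apply: artinian_powers; rewrite ?(leq_trans _ nm) // /row_full eqn_leq rank_leq_col.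
apply: dense_open_generically.
have E1 : dense_open (fun a : 'rV[K]_n.+1 => a 0 ord_max != 0).
  exists (fun a : 'rV[K]_n.+1 => a 0 ord_max); first exact: polyfun_entry.
  by split=> //; exists a0; rewrite mxE !eqxx oner_neq0.
have E2 : dense_open (fun a : 'rV[K]_n.+1 => forall nu, (nu < nu1)%N ->
    row_free (power_mx d nu (restr L a)) || row_full (power_mx d nu (restr L a))).
  apply: dense_open_all => // nu nu1'; apply: dense_open_free_full => [i j|].
    exact: restr_polyfunr.
  by exists a0; apply: gL.
have E3 : dense_open (fun a : 'rV[K]_n.+1 => row_full (power_mx d nu1 (restr L a))).
  apply: dense_open_full => [i j|]; first exact: restr_polyfunr.
  by exists a0.
apply: dense_open_sub (dense_openI charK E1 (dense_openI charK E2 E3)) => a [ha [ga fa]] i.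
apply: max_rank_restr => // nu.
have surj_full nu' : row_full (power_mx d nu' (restr L a)) -> surjective_at d nu' (restr L a).
  by move=> h p hp; exact: power_mx_surj h hp.
(* Surjectivity passes from [nu1] to all larger degrees, which leaves finitely many [nu]. *)
have [lt|ge] := ltnP nu nu1; last first.
  right=> p; apply: (in_powers_homog_leq (surj_full _ fa)).
  by rewrite leq_add2r.
have /orP[h|h] := ga nu lt; last by right; apply: surj_full.
by left=> c hc c0; exact: power_mx_inj h hc c0.
Qed.

Theorem proposition9p2 (K : fieldType) (charK : [pchar K] =i pred0) :
  (forall (k d : nat) (k_ge2 : (2 <= k)%N) (d_gt0 : (0 < d)%N),
     generically (fun L : 'M[K]_(k ^ 2, 4) =>
       weak_lefschetz (power_idealr d_gt0 L)))
  /\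
  (forall (d : nat) (d_gt0 : (0 < d)%N),
     generically (fun L : 'M[K]_(8, 5) =>
       weak_lefschetz (power_idealr d_gt0 L))).
Proof.
split=> [k d k_ge2|d] d_gt0.
  (* At [nu1 = d] the degree is [d + d], which is below [2 * d.+1] and hence below [k * d.+1]. *)
  apply: (@generically_weak_lefschetz _ charK _ _ _ _ d) => [|nu|].
  - by rewrite -mulnn; apply: leq_trans (leq_mul k_ge2 k_ge2).
  - by have [L [h _]] := planar_full charK nu d k_ge2; exists L.
  have [L [_ h]] := planar_full charK d d k_ge2; exists L; apply: h.
  by apply: leq_trans (leq_mul k_ge2 (leqnn d.+1)); lia.
apply: (@generically_weak_lefschetz _ charK _ _ _ _ d) => // [nu|].
  by have [L [h _]] := spatial_full charK nu d; exists L.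
by have [L [_ h]] := spatial_full charK d d; exists L; apply: h; lia.
Qed.
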